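(* Let $n\geq 1$ and $0\leq k<n$ be integers, and let $\varepsilon\in\{0,1\}$. Then \[ \int_0^\infty \frac{\sinh^{2k+1}x}{x\cosh^{2n+\varepsilon}x}\,dx = \sum_{p=1}^{n} \frac{\Phi\!\left(2\varepsilon-1,\,2p+\varepsilon,\,\frac12\right)}{\pi^{2p-1+\varepsilon}}\, [z^{2n-1+\varepsilon}]\,(z^2-1)^k(\arcsin z)^{2p-1+\varepsilon}. \]
   Context: $\Phi(q,s,a)=\sum_{j=0}^{\infty}\frac{q^j}{(j+a)^s}$ is the Lerch transcendent (in its domain of convergence). With $\beta(s)=\sum_{j\ge0}(-1)^j(2j+1)^{-s}$ the Dirichlet beta function and $\zeta$ the Riemann zeta function, $\Phi(2\varepsilon-1,2p+\varepsilon,\frac12)$ equals $2^{2p}\beta(2p)$ for $\varepsilon=0$ and $(2^{2p+1}-1)\zeta(2p+1)$ for $\varepsilon=1$. $[z^r]F(z)$ denotes the coefficient of $z^r$ in the expansion of $F$ at the origin; $\arcsin z$ is expanded as its Taylor series at $0$ (with $\arcsin 0=0$). *)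

(* Defs.v *)
(* Stdlib real numbers with Coquelicot. *)
From Stdlib Require Import Arith Reals.
From Coquelicot Require Import Coquelicot.

Open Scope R_scope.

(* Lerch transcendent for real arguments.  Rpower x s = exp (s * ln x) is the
   real power only when x > 0, so this is meaningful for 0 < a; Series is the
   value of the sum only where the series converges. *)
Definition Lerch (q s a : R) : R :=
  Series (fun j : nat => q ^ j / Rpower (INR j + a) s).

(* [z^r] F(z): the r-th Taylor coefficient at the origin, for F smooth near 0. *)
Definition coef0 (r : nat) (F : R -> R) : R :=
  Derive_n F r 0 / INR (fact r).

(* Main.v *)
Require Import Defs.
From Stdlib Require Import Arith Reals.
From Coquelicot Require Import Coquelicot.
From Stdlib Require Import Lra Lia Psatz.

Open Scope R_scope.

(* For z = sin t, expanding sinh x / (cosh x - z) - tanh x in powers of z shows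
   that the integrals of sinh x / (x cosh^m x) are the Taylor coefficients in z of
   the integral of (sinh x / (cosh x - sin t) - tanh x) / x.  The partial fractions
     sinh x / (cosh x - sin t) = sum_j 2x / (x^2 + p_j^2),
     p_j = pi (j + 1/2) - (-1)^j t,
   evaluate the latter integral as
     sum_j (pi / p_j(t) - pi / p_j(0))
       = sum_(s >= 1) Phi((-1)^s, s + 1, 1/2) (t / pi)^s.
   Substituting t = arcsin z and comparing coefficients gives the case k = 0 (terms
   of the wrong parity vanish); writing sinh^2 = cosh^2 - 1 and inducting on k turns
   into multiplication by z^2 - 1 on the coefficient side. *)

(** * Finite sums *)

(** The value at [z = 0] is subtracted throughout because neither the integral of [tanh x / x] nor
    the sum of [PI / p_j] converges; only the differences do. No infinite sum is ever exchanged with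
    an integral. The partial fractions carry an error that is explicit in [x] and in the number of
    terms, the integral is cut off at both ends, and the expansions in [t] and in [sin t] are finite
    sums with remainders bounded by powers of [t] and [sin t]. Only inequalities between real
    sequences pass to the limit. In the same way, coefficients are compared not through convergent
    power series but through uniqueness of an expansion with remainder [O(z^m)] as [z] tends to 0
    from the right. The partial fractions use no complex analysis: one estimate near the leading
    pole, for [x <= 1], is propagated to all [x] by a formula that expresses the kernel at [x]
    through the kernel at [x / 2]. *)

Fixpoint psum (f : nat -> R) (n : nat) : R :=
  match n with 0%nat => 0 | S m => psum f m + f m end.

Lemma psum_ext f g n : (forall j, (j < n)%nat -> f j = g j) -> psum f n = psum g n.
Proof.
  induction n as [|n IH]; intros H; simpl; [reflexivity|].
  rewrite IH by (intros; apply H; lia). rewrite (H n) by lia. reflexivity.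
Qed.

Lemma psum_plus f g n : psum (fun j => f j + g j) n = psum f n + psum g n.
Proof. induction n as [|n IH]; simpl; [ring|rewrite IH; ring]. Qed.

Lemma psum_scal c f n : psum (fun j => c * f j) n = c * psum f n.
Proof. induction n as [|n IH]; simpl; [ring|rewrite IH; ring]. Qed.

Lemma psum_le f g n : (forall j, (j < n)%nat -> f j <= g j) -> psum f n <= psum g n.
Proof.
  induction n as [|n IH]; intros H; simpl; [lra|].
  apply Rplus_le_compat; [apply IH; intros; apply H; lia|apply H; lia].
Qed.

Lemma Rabs_psum f n : Rabs (psum f n) <= psum (fun j => Rabs (f j)) n.
Proof.
  induction n as [|n IH]; simpl; [rewrite Rabs_R0; lra|].
  eapply Rle_trans; [apply Rabs_triang|]. lra.
Qed.

Lemma psum_S_l f n : psum f (S n) = f 0%nat + psum (fun j => f (S j)) n.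
Proof. induction n as [|n IH]; simpl in *; [ring|rewrite IH; ring]. Qed.

Lemma psum_double f n :
  psum f (2 * n) = psum (fun j => f (2 * j)%nat + f (2 * j + 1)%nat) n.
Proof.
  induction n as [|n IH]; [reflexivity|].
  replace (2 * S n)%nat with (S (S (2 * n))) by lia.
  cbn [psum]. rewrite IH. replace (2 * n + 1)%nat with (S (2 * n)) by lia. ring.
Qed.

Lemma sum_n_psum f n : sum_n f n = psum f (S n).
Proof.
  induction n as [|n IH]; simpl; [rewrite sum_O; symmetry; apply Rplus_0_l|].
  rewrite sum_Sn, IH. reflexivity.
Qed.

(** * Partial fractions of the kernel *)

(** The mean value theorem for [g - f]. Applied repeatedly, each bound serving as the derivative
    comparison for the next, it yields the Taylor-type bounds below. *)
Lemma le_of_derive_le (f g df dg : R -> R) (b : R) :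
  0 <= b -> f 0 <= g 0 ->
  (forall t, 0 <= t <= b -> is_derive f t (df t)) ->
  (forall t, 0 <= t <= b -> is_derive g t (dg t)) ->
  (forall t, 0 <= t <= b -> df t <= dg t) -> f b <= g b.
Proof.
  intros Hb H0 Hf Hg Hd.
  destruct (MVT_gen (fun t => g t - f t) 0 b (fun t => dg t - df t)) as [c [Hc E]].
  - intros x Hx. rewrite Rmin_left, Rmax_right in Hx by lra.
    exact (is_derive_minus g f x _ _ (Hg x ltac:(lra)) (Hf x ltac:(lra))).
  - intros x Hx. rewrite Rmin_left, Rmax_right in Hx by lra.
    apply continuity_pt_filterlim.
    apply (ex_derive_continuous (K:=R_AbsRing) (V:=R_NormedModule) (fun t : R => g t - f t) x).
    exists (dg x - df x). exact (is_derive_minus g f x _ _ (Hg x Hx) (Hf x Hx)).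
  - rewrite Rmin_left, Rmax_right in Hc by lra.
    pose proof (Hd c Hc). nra.
Qed.

Ltac prove_derive :=
  intros; first
  [ apply is_derive_Reals, derivable_pt_lim_sinh
  | apply is_derive_Reals, derivable_pt_lim_cosh
  | auto_derive; [exact I | first [ring | field]] ].

Ltac by_derivatives f g df dg :=
  apply (le_of_derive_le f g df dg); [lra | | prove_derive | prove_derive | ].

(** * Polynomial bounds for the trigonometric and hyperbolic functions *)

Lemma sin_le x : 0 <= x -> sin x <= x.
Proof.
  intros Hx. by_derivatives sin (fun t : R => t) cos (fun _ : R => 1).
  - rewrite sin_0; lra.
  - intros t _. apply COS_bound.
Qed.

Lemma cos_ge x : 0 <= x -> 1 - x ^ 2 / 2 <= cos x.
Proof.
  intros Hx.
  by_derivatives (fun t => 1 - t ^ 2 / 2) cos (fun t => - t) (fun t => - sin t).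
  - rewrite cos_0; lra.
  - intros t Ht. pose proof (sin_le t). lra.
Qed.

Lemma sin_ge x : 0 <= x -> x - x ^ 3 / 6 <= sin x.
Proof.
  intros Hx.
  by_derivatives (fun t => t - t ^ 3 / 6) sin (fun t => 1 - t ^ 2 / 2) cos.
  - rewrite sin_0; lra.
  - intros t Ht. apply cos_ge; lra.
Qed.

Lemma cos_le x : 0 <= x -> cos x <= 1 - x ^ 2 / 2 + x ^ 4 / 24.
Proof.
  intros Hx.
  by_derivatives cos (fun t => 1 - t ^ 2 / 2 + t ^ 4 / 24) (fun t => - sin t) (fun t => - t + t ^ 3 / 6).
  - rewrite cos_0; lra.
  - intros t Ht. pose proof (sin_ge t). lra.
Qed.

Lemma cosh_ge_1 x : 1 <= cosh x.
Proof.
  unfold cosh. pose proof (exp_pos x). pose proof (exp_pos (- x)).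
  assert (exp x * exp (- x) = 1) by (rewrite <- exp_plus, Rplus_opp_r; apply exp_0).
  pose proof (pow2_ge_0 (exp x - exp (- x))).
  apply Rnot_lt_le. intros Hlt.
  assert ((exp x + exp (- x)) * (exp x + exp (- x)) < 2 * 2)
    by (apply Rmult_le_0_lt_compat; lra).
  nra.
Qed.

Lemma cosh_ge_exp x : exp x / 2 <= cosh x.
Proof. unfold cosh. pose proof (exp_pos (- x)). lra. Qed.

Lemma sinh_ge x : 0 <= x -> x <= sinh x.
Proof.
  intros Hx. by_derivatives (fun t : R => t) sinh (fun _ : R => 1) cosh.
  - rewrite sinh_0; lra.
  - intros t _. apply cosh_ge_1.
Qed.

Lemma cosh_ge x : 0 <= x -> 1 + x ^ 2 / 2 <= cosh x.
Proof.
  intros Hx.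
  by_derivatives (fun t => 1 + t ^ 2 / 2) cosh (fun t : R => t) sinh.
  - rewrite cosh_0; lra.
  - intros t Ht. apply sinh_ge; lra.
Qed.

Lemma sinh_le_x_cosh x : 0 <= x -> sinh x <= x * cosh x.
Proof.
  intros Hx.
  by_derivatives sinh (fun t => t * cosh t) cosh (fun t => cosh t + t * sinh t).
  - rewrite sinh_0; lra.
  - intros t Ht. pose proof (sinh_ge t). nra.
Qed.

Lemma cosh_le_2 x : 0 <= x <= 1 -> cosh x <= 2.
Proof.
  intros Hx. unfold cosh.
  assert (exp x <= 3).
  { apply Rle_trans with (exp 1); [|apply exp_le_3].
    destruct (Req_dec x 1) as [->|]; [lra|]. apply Rlt_le, exp_increasing; lra. }
  assert (exp (- x) <= 1).
  { rewrite <- exp_0. destruct (Req_dec x 0) as [->|]; [rewrite Ropp_0; lra|].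
    apply Rlt_le, exp_increasing; lra. }
  lra.
Qed.

Lemma sinh_le_small x : 0 <= x <= 1 -> sinh x <= 2 * x.
Proof.
  intros Hx. by_derivatives sinh (fun t => 2 * t) cosh (fun _ : R => 2).
  - rewrite sinh_0; lra.
  - intros t Ht. apply cosh_le_2; lra.
Qed.

Lemma cosh_le_small x : 0 <= x <= 1 -> cosh x <= 1 + x ^ 2.
Proof.
  intros Hx. by_derivatives cosh (fun t => 1 + t ^ 2) sinh (fun t => 2 * t).
  - rewrite cosh_0; lra.
  - intros t Ht. apply sinh_le_small; lra.
Qed.

Lemma sinh_le_cubic x : 0 <= x <= 1 -> sinh x <= x + x ^ 3 / 3.
Proof.
  intros Hx. by_derivatives sinh (fun t => t + t ^ 3 / 3) cosh (fun t => 1 + t ^ 2).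
  - rewrite sinh_0; lra.
  - intros t Ht. apply cosh_le_small; lra.
Qed.

Lemma cosh_le_quartic x : 0 <= x <= 1 -> cosh x <= 1 + x ^ 2 / 2 + x ^ 4 / 12.
Proof.
  intros Hx.
  by_derivatives cosh (fun t => 1 + t ^ 2 / 2 + t ^ 4 / 12) sinh (fun t => t + t ^ 3 / 3).
  - rewrite cosh_0; lra.
  - intros t Ht. apply sinh_le_cubic; lra.
Qed.

(** With [v = u / 2 <= 2], [1 - cos u = 2 sin^2 v] and [sin v >= v - v^3 / 6 >= v / 3]. The range up
    to 4 covers [u = PI / 2 - t] for every [t] in [[-PI/2, PI/2]]. *)
Lemma one_minus_cos_ge u : 0 <= u <= 4 -> u ^ 2 / 18 <= 1 - cos u.
Proof.
  intros Hu. replace u with (2 * (u / 2)) at 2 by field.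
  rewrite cos_2a_sin. pose proof (sin_ge (u / 2)).
  set (v := u / 2) in *. replace u with (2 * v) by (unfold v; field).
  assert (0 <= v <= 2) by (unfold v; lra).
  assert (v / 3 <= sin v) by nra.
  nra.
Qed.

(** * The kernel, its poles and its partial fractions *)

Definition kern (x t : R) : R := sinh x / (cosh x - sin t).

(** These are solutions of [cos p = sin t], so [cosh x - sin t] vanishes at [x = i p] and
    [x = - i p]. *)
Definition pole (t : R) (j : nat) : R := PI * (INR j + 1 / 2) - (-1) ^ j * t.

Lemma cosh_gt_1 x : 0 < x -> 1 < cosh x.
Proof. intros Hx. pose proof (cosh_ge x). nra. Qed.

Lemma cosh_sub_sin_pos x t : 0 < x -> 0 < cosh x - sin t.
Proof. intros Hx. pose proof (cosh_gt_1 x Hx). pose proof (SIN_bound t). lra. Qed.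

(** With [u = PI / 2 - t], [D = cosh x - cos u] and [Q = x^2 + u^2], the fourth-order bounds give
    [2 D = Q + O(Q^2)]. Removing the leading pole therefore leaves a numerator of size at most
    [x Q^2] over [D Q], and [D >= Q / 18] gives the constant, uniformly as [u] tends to 0. *)
Lemma kern_base x t : 0 < x <= 1 -> - (PI / 2) <= t <= PI / 2 ->
  Rabs (kern x t - 2 * x / (x ^ 2 + (PI / 2 - t) ^ 2)) <= 18 * x.
Proof.
  intros Hx Ht. unfold kern.
  pose proof (cosh_sub_sin_pos x t ltac:(lra)) as HD.
  rewrite <- cos_shift in *.
  set (u := PI / 2 - t) in *.
  assert (Hu : 0 <= u <= 4) by (unfold u; pose proof PI_4; lra).
  pose proof (one_minus_cos_ge u Hu) as Hu0.
  pose proof (cos_ge u ltac:(lra)) as Hu1. pose proof (cos_le u ltac:(lra)) as Hu2.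
  pose proof (cosh_ge x ltac:(lra)) as Hc1.
  pose proof (cosh_le_quartic x ltac:(lra)) as Hc2.
  pose proof (sinh_ge x ltac:(lra)) as Hs1. pose proof (sinh_le_cubic x ltac:(lra)) as Hs2.
  set (D := cosh x - cos u) in *. set (Q := x ^ 2 + u ^ 2).
  assert (HQ : 0 < Q) by (unfold Q; nra).
  assert (HDQ : Q / 18 <= D) by (unfold D, Q; pose proof (pow2_ge_0 x); lra).
  replace (sinh x / D - 2 * x / Q) with
    (((sinh x - x) * Q + x * (Q - 2 * D)) / (D * Q)) by (field; lra).
  assert (HDQ0 : 0 < D * Q) by nra.
  unfold Rdiv. rewrite Rabs_mult, (Rabs_pos_eq (/ (D * Q))) by (left; apply Rinv_0_lt_compat, HDQ0).
  apply Rle_div_l; [exact HDQ0|].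
  apply Rle_trans with (x * Q ^ 2);
    [|replace (x * Q ^ 2) with (x * (18 * (Q / 18 * Q))) by field;
      replace (18 * x * (D * Q)) with (x * (18 * (D * Q))) by ring;
      repeat apply Rmult_le_compat_l; try lra; apply Rmult_le_compat_r; lra].
  assert (x ^ 2 <= Q) by (unfold Q; nra).
  assert (u ^ 2 <= Q) by (unfold Q; nra).
  assert (0 <= (sinh x - x) * Q <= x * Q ^ 2 / 3).
  { split; [apply Rmult_le_pos; lra|].
    apply Rle_trans with ((x * x ^ 2 / 3) * Q); [apply Rmult_le_compat_r; [lra|]|].
    - simpl in *; lra.
    - assert (x * x ^ 2 <= x * Q) by (apply Rmult_le_compat_l; lra). nra. }
  assert (x ^ 4 <= Q ^ 2)
    by (replace (x ^ 4) with ((x ^ 2) ^ 2) by ring; apply pow_incr; split; [apply pow2_ge_0|lra]).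
  assert (u ^ 4 <= Q ^ 2)
    by (replace (u ^ 4) with ((u ^ 2) ^ 2) by ring; apply pow_incr; split; [apply pow2_ge_0|lra]).
  assert (- (Q ^ 2 / 6) <= Q - 2 * D <= Q ^ 2 / 6).
  { unfold D. replace Q with (x ^ 2 + u ^ 2) at 2 3 by reflexivity. split; lra. }
  apply Rabs_le. nra.
Qed.

(** With [y = x / 2] and [v = PI / 4 + t / 2], one has [sin t = 2 sin^2 v - 1] and
    [cosh x = 2 cosh^2 y - 1], so the denominator factors as
    [2 (cosh y - sin v) (cosh y + sin v)]. *)
Lemma kern_duplication x t : 0 < x ->
  kern x t = (kern (x / 2) (PI / 4 + t / 2) + kern (x / 2) (- (PI / 4 + t / 2))) / 2.
Proof.
  intros Hx. unfold kern. set (v := PI / 4 + t / 2).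
  set (y := x / 2). replace x with (2 * y) by (unfold y; field).
  assert (Hy : 0 < y) by (unfold y; lra).
  pose proof (cosh_sub_sin_pos y v Hy). pose proof (cosh_sub_sin_pos y (- v) Hy).
  rewrite sin_neg in *.
  assert (E : sin t = 2 * sin v ^ 2 - 1).
  { replace t with (- (PI / 2 - 2 * v)) by (unfold v; field).
    rewrite sin_neg, sin_shift, cos_2a_sin. ring. }
  assert (Ee : exp (2 * y) = exp y ^ 2) by (replace (2 * y) with (y + y) by ring; rewrite exp_plus; ring).
  assert (Em : exp (- (2 * y)) = exp (- y) ^ 2)
    by (replace (- (2 * y)) with (- y + - y) by ring; rewrite exp_plus; ring).
  assert (E1 : exp y * exp (- y) = 1) by (rewrite <- exp_plus, Rplus_opp_r; apply exp_0).
  assert (Es : sinh (2 * y) = 2 * sinh y * cosh y) by (unfold sinh, cosh; rewrite Ee, Em; field).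
  assert (Ec : cosh (2 * y) = 2 * cosh y ^ 2 - 1).
  { unfold cosh. rewrite Ee, Em.
    replace (2 * ((exp y + exp (- y)) / 2) ^ 2 - 1) with
      ((exp y ^ 2 + exp (- y) ^ 2) / 2 + (exp y * exp (- y) - 1)) by field.
    rewrite E1. ring. }
  rewrite Es, Ec, E. field. repeat split; try lra.
  replace (2 * cosh y ^ 2 - 1 - (2 * sin v ^ 2 - 1)) with
    (2 * ((cosh y - sin v) * (cosh y - - sin v))) by ring.
  nra.
Qed.

(* Both sides satisfy the same duplication formula, which halves the error while
   doubling the number of terms. *)
Lemma kern_partial_fractions n : forall x t, 0 < x <= 2 ^ n ->
  - (PI / 2) <= t <= PI / 2 ->
  Rabs (kern x t - psum (fun j => 2 * x / (x ^ 2 + pole t j ^ 2)) (2 ^ n))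
    <= 18 * x / 2 ^ n.
Proof.
  induction n as [|n IH]; intros x t Hx Ht.
  (* Here [x <= 2 ^ 0], the range of [kern_base]; [n] halvings bring every [x <= 2 ^ n] into it. *)
  - simpl in *. replace (pole t 0) with (PI / 2 - t) by (unfold pole; simpl; field).
    rewrite Rplus_0_l, Rdiv_1_r. apply kern_base; lra.
  - pose proof (pow_lt 2 n ltac:(lra)) as Hp. simpl pow in Hx.
    rewrite kern_duplication by lra. set (v := PI / 4 + t / 2).
    assert (Hv : - (PI / 2) <= v <= PI / 2) by (unfold v; lra).
    pose proof (IH (x / 2) v ltac:(lra) Hv) as H1.
    pose proof (IH (x / 2) (- v) ltac:(lra) ltac:(lra)) as H2.
    replace (2 ^ S n)%nat with (2 * 2 ^ n)%nat by reflexivity. rewrite psum_double.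
    rewrite (psum_ext _ (fun j => / 2 * (2 * (x / 2) / ((x / 2) ^ 2 + pole v j ^ 2)
      + 2 * (x / 2) / ((x / 2) ^ 2 + pole (- v) j ^ 2)))).
    + rewrite psum_scal, psum_plus.
      apply Rabs_le_between in H1. apply Rabs_le_between in H2. apply Rabs_le.
      replace (18 * x / 2 ^ S n) with (18 * (x / 2) / 2 ^ n) by (simpl; field; lra).
      lra.
    + intros j _.
      assert (Hh : forall p, 2 * x / (x ^ 2 + (2 * p) ^ 2)
                             = / 2 * (2 * (x / 2) / ((x / 2) ^ 2 + p ^ 2))).
      { intros p. pose proof (pow2_ge_0 p). field. nra. }
      (* The poles [2 j] and [2 j + 1] of [t] are twice the [j]-th poles of [v] and [- v]; the
         parity of [j] decides which is which. *)
      assert (Hs : (-1) ^ j = 1 \/ (-1) ^ j = -1).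
      { destruct (Nat.Even_or_Odd j) as [[i ->]|[i ->]];
          [left; apply pow_1_even|right; rewrite Nat.add_1_r; apply pow_1_odd]. }
      destruct Hs as [Hs|Hs].
      * replace (pole t (2 * j)) with (2 * pole v j)
          by (unfold pole, v; rewrite pow_1_even, mult_INR, Hs; simpl; field).
        replace (pole t (2 * j + 1)) with (2 * pole (- v) j)
          by (unfold pole, v; rewrite Nat.add_1_r, pow_1_odd, S_INR, mult_INR, Hs; simpl; field).
        rewrite !Hh. ring.
      * replace (pole t (2 * j)) with (2 * pole (- v) j)
          by (unfold pole, v; rewrite pow_1_even, mult_INR, Hs; simpl; field).
        replace (pole t (2 * j + 1)) with (2 * pole v j)
          by (unfold pole, v; rewrite Nat.add_1_r, pow_1_odd, S_INR, mult_INR, Hs; simpl; field).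
        rewrite !Hh. ring.
Qed.

(** * Improper integrals over the half line *)

Notation int0oo f l := (is_RInt_gen (V := R_NormedModule) f (at_right 0) (Rbar_locally p_infty) l).

Lemma at_right_prod_infty (P : R * R -> Prop) (d B : R) : 0 < d ->
  (forall a b, 0 < a < d -> B < b -> P (a, b)) ->
  filter_prod (at_right 0) (Rbar_locally p_infty) P.
Proof.
  intros Hd H.
  apply (Filter_prod _ _ _ (fun a => 0 < a < d) (fun b => B < b)).
  - exists (mkposreal d Hd). intros a Ha Ha0. split; [exact Ha0|].
    apply Rabs_def2 in Ha. simpl in Ha. unfold minus, plus, opp in Ha; simpl in Ha. lra.
  - exists B. auto.
  - intros a b Ha Hb. apply H; assumption.
Qed.

Lemma continuous_of_ex_derive (f : R -> R) x : ex_derive f x -> continuous f x.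
Proof. apply (ex_derive_continuous (K:=R_AbsRing) (V:=R_NormedModule)). Qed.

Lemma is_RInt_exp_opp a b : is_RInt (fun x => exp (- x)) a b (exp (- a) - exp (- b)).
Proof.
  replace (exp (- a) - exp (- b)) with (minus (- exp (- b)) (- exp (- a)))
    by (unfold minus, plus, opp; simpl; ring).
  apply (is_RInt_derive (fun x => - exp (- x)) (fun x => exp (- x))).
  - intros x _. auto_derive; [exact I|ring].
  - intros x _. apply continuous_of_ex_derive.
    auto_derive. exact I.
Qed.

(** The majorant bounds an integral from [a] to [b] by [C] times the difference of [exp (- a)] and
    [exp (- b)], which is small when both ends are near 0 or both are large. Continuity is asked
    only for [x > 0] because the integrands divide by [x]. *)
Definition dominated (C : R) (f : R -> R) : Prop :=
  (forall x, 0 < x -> continuous f x)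
  /\ (forall x, 0 < x -> Rabs (f x) <= C * exp (- x)).

Lemma dominated_ex_RInt C f a b : dominated C f -> 0 < a -> 0 < b -> ex_RInt f a b.
Proof.
  intros [fcont _] Ha Hb. apply (ex_RInt_continuous (V:=R_CompleteNormedModule)).
  intros z Hz. apply fcont. pose proof (Rmin_glb_lt a b 0 Ha Hb). lra.
Qed.

Lemma dominated_bound_le C f a b : dominated C f -> 0 < a <= b ->
  Rabs (RInt f a b) <= C * (exp (- a) - exp (- b)).
Proof.
  intros Hf Hab.
  apply (norm_RInt_le (V:=R_NormedModule) f (fun x => C * exp (- x)) a b).
  - lra.
  - intros x Hx. apply (proj2 Hf); lra.
  - apply (RInt_correct f), (dominated_ex_RInt C f a b Hf); lra.
  - apply (is_RInt_scal (V:=R_NormedModule)), is_RInt_exp_opp.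
Qed.

Lemma dominated_bound C f a b : dominated C f -> 0 < a -> 0 < b ->
  Rabs (RInt f a b) <= C * Rabs (exp (- a) - exp (- b)).
Proof.
  intros Hf Ha Hb.
  assert (Hmono : forall u v, u <= v -> exp (- v) <= exp (- u)).
  { intros u v [Huv| ->]; [apply Rlt_le, exp_increasing; lra|lra]. }
  destruct (Rle_dec a b) as [Hab|Hab].
  - rewrite (Rabs_pos_eq (exp (- a) - exp (- b))) by (specialize (Hmono a b Hab); lra).
    apply (dominated_bound_le C f); [exact Hf|lra].
  - rewrite <- (opp_RInt_swap (V:=R_CompleteNormedModule) f) by (apply (dominated_ex_RInt C f); [exact Hf|lra|lra]).
    change (opp (RInt f b a)) with (- RInt f b a). rewrite Rabs_Ropp.
    rewrite (Rabs_minus_sym (exp (- a))), (Rabs_pos_eq (exp (- b) - exp (- a))) by (specialize (Hmono b a ltac:(lra)); lra).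
    apply (dominated_bound_le C f); [exact Hf|lra].
Qed.

(** Cauchy's criterion in both endpoints at once; the bound on [l] holds because [exp (- x)] has
    total mass 1 on the half line. *)
Lemma dominated_is_RInt_gen C f : dominated C f -> exists l, int0oo f l /\ Rabs l <= C.
Proof.
  intros Hf.
  assert (HC : 0 <= C).
  { pose proof (proj2 Hf 1 ltac:(lra)). pose proof (Rabs_pos (f 1)).
    pose proof (exp_pos (Ropp 1)). nra. }
  destruct (proj1 (filterlim_locally_cauchy
     (F := filter_prod (at_right 0) (Rbar_locally p_infty))
     (U := R_CompleteSpace) (fun ab => RInt f (fst ab) (snd ab)))) as [l Hl].
  - intros eps. destruct eps as [e He]; simpl.
    (* Moving either end of the interval costs at most [C h], and [2 C h < e]; the 1 added to [C]
       avoids dividing by zero. *)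
    set (h := e / (4 * (C + 1))).
    assert (Hh : 0 < h) by (unfold h; apply Rdiv_lt_0_compat; lra).
    assert (HCh : C * (2 * h) < e).
    { unfold h. apply Rle_lt_trans with (e / 2 * (C / (C + 1))); [right; field; lra|].
      apply Rle_lt_trans with (e / 2 * 1); [|lra]. apply Rmult_le_compat_l; [lra|].
      apply Rle_div_l; lra. }
    exists (fun ab => 0 < fst ab < h /\ Rmax 0 (- ln h) < snd ab). split.
    + apply at_right_prod_infty with h (Rmax 0 (- ln h)); simpl; auto.
    + intros [a b] [a' b'] [[Ha Ha1] Hb] [[Ha' Ha1'] Hb']. simpl in *.
      assert (Hbpos : forall u, Rmax 0 (- ln h) < u -> 0 < u /\ 0 < exp (- u) < h).
      { intros u Hu. pose proof (Rmax_l 0 (- ln h)). pose proof (Rmax_r 0 (- ln h)).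
        split; [lra|]. split; [apply exp_pos|].
        rewrite <- (exp_ln h) at 1 by exact Hh. apply exp_increasing. lra. }
      assert (Hapos : forall u, 0 < u < h -> 1 - h < exp (- u) < 1).
      { intros u Hu. split.
        - pose proof (exp_ineq1 (- u)). lra.
        - rewrite <- exp_0. apply exp_increasing. lra. }
      destruct (Hbpos b Hb) as [Hb0 Hb1]. destruct (Hbpos b' Hb') as [Hb0' Hb1'].
      pose proof (Hapos a ltac:(lra)). pose proof (Hapos a' ltac:(lra)).
      change (Rabs (RInt f a' b' - RInt f a b) < e).
      rewrite <- (RInt_Chasles f a' a b'), <- (RInt_Chasles f a b b')
        by (apply (dominated_ex_RInt C f); [exact Hf|lra|lra]).
      unfold plus; simpl.
      replace (RInt f a' a + (RInt f a b + RInt f b b') - RInt f a b)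
        with (RInt f a' a + RInt f b b') by ring.
      eapply Rle_lt_trans; [apply Rabs_triang|].
      pose proof (dominated_bound C f a' a Hf ltac:(lra) ltac:(lra)).
      pose proof (dominated_bound C f b b' Hf ltac:(lra) ltac:(lra)).
      assert (Rabs (exp (- a') - exp (- a)) <= h) by (apply Rabs_le; lra).
      assert (Rabs (exp (- b) - exp (- b')) <= h) by (apply Rabs_le; lra).
      nra.
  - exists l. assert (Hint : int0oo f l).
    { intros P HP. specialize (Hl P HP). unfold filtermap in Hl. unfold filtermapi.
      refine (filter_imp _ _ _ (filter_and _ _ Hl
        (at_right_prod_infty (fun ab => 0 < fst ab /\ 0 < snd ab) 1 0 Rlt_0_1 _))).
      - intros [a b] [H1 [H2 H3]]. exists (RInt f a b). split; [|exact H1].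
        apply (RInt_correct f), (dominated_ex_RInt C f); assumption.
      - simpl; intros; split; lra. }
    split; [exact Hint|].
    apply Rnot_lt_le. intros Hlt.
    assert (He : 0 < Rabs l - C) by lra.
    pose proof (proj1 (filterlim_locally _ _) Hl (mkposreal _ He)) as H1.
    pose proof (filter_and _ _ H1
      (at_right_prod_infty (fun ab => 0 < fst ab /\ 0 < snd ab) 1 0 Rlt_0_1
         ltac:(simpl; intros; split; lra))) as H2.
    destruct (filter_ex _ H2) as [[a b] [H3 [Ha Hb]]]. simpl in *.
    change (Rabs (RInt f a b - l) < Rabs l - C) in H3.
    pose proof (dominated_bound C f a b Hf Ha Hb) as H4.
    assert (Rabs (exp (- a) - exp (- b)) <= 1).
    { assert (forall u, 0 < u -> 0 < exp (- u) < 1) as Hu.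
      { intros u Hu. split; [apply exp_pos|]. rewrite <- exp_0. apply exp_increasing. lra. }
      pose proof (Hu a Ha). pose proof (Hu b Hb). apply Rabs_le. lra. }
    pose proof (Rabs_triang_inv l (RInt f a b)). rewrite Rabs_minus_sym in H3. nra.
Qed.

Lemma int0oo_ext f g l : (forall x, 0 < x -> f x = g x) -> int0oo f l -> int0oo g l.
Proof.
  intros H. apply is_RInt_gen_ext.
  apply at_right_prod_infty with 1 0; [lra|]. intros a b Ha Hb x Hx. simpl in Hx. apply H.
  pose proof (Rmin_glb_lt a b 0 ltac:(lra) ltac:(lra)). lra.
Qed.

Lemma int0oo_scal f c l : int0oo f l -> int0oo (fun x => c * f x) (c * l).
Proof. exact (is_RInt_gen_scal f c l). Qed.

Lemma int0oo_plus f g lf lg : int0oo f lf -> int0oo g lg ->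
  int0oo (fun x => f x + g x) (lf + lg).
Proof. exact (is_RInt_gen_plus f g lf lg). Qed.

Lemma int0oo_zero : int0oo (fun _ => 0) 0.
Proof.
  apply (int0oo_ext (fun x => 0 * exp (- x)) _ 0 (fun x _ => Rmult_0_l _)).
  destruct (dominated_is_RInt_gen 1 (fun x => exp (- x))) as [l [Hl _]]; [split|].
  - intros x _. apply continuous_of_ex_derive.
    auto_derive. exact I.
  - intros x _. rewrite Rabs_pos_eq by (left; apply exp_pos). lra.
  - rewrite <- (Rmult_0_l l) at 2. apply int0oo_scal, Hl.
Qed.

Lemma int0oo_psum (f : nat -> R -> R) l n :
  (forall i, (i < n)%nat -> int0oo (f i) (l i)) ->
  int0oo (fun x => psum (fun i => f i x) n) (psum l n).
Proof.
  induction n as [|n IH]; intros H; simpl; [apply int0oo_zero|].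
  apply int0oo_plus; [apply IH; intros; apply H; lia|apply H; lia].
Qed.

(** Allows the improper integral to be evaluated along one convenient pair of cutoff sequences. *)
Lemma int0oo_seq f l (u v : nat -> R) (I : nat -> R) : int0oo f l ->
  (forall m, 0 < u m) -> is_lim_seq u 0 -> is_lim_seq v p_infty ->
  (forall m, is_RInt f (u m) (v m) (I m)) -> is_lim_seq I l.
Proof.
  intros Hf Hu0 Hu Hv HI P HP. specialize (Hf P HP).
  destruct Hf as [Q S [d HQ] HS HQS].
  pose proof (Hv S HS) as H1.
  pose proof (Hu (ball 0 d) (locally_ball 0 d)) as H2.
  unfold filtermap in *. generalize (filter_and _ _ H1 H2). apply filter_imp.
  intros m [HSm Hdm].
  destruct (HQS (u m) (v m) (HQ _ Hdm (Hu0 m)) HSm) as [y [Hy Py]]. simpl in Hy.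
  rewrite <- (is_RInt_unique _ _ _ _ (HI m)), (is_RInt_unique _ _ _ _ Hy). exact Py.
Qed.

(** * Integrating the partial fractions *)

Definition half (j : nat) : R := INR j + 1 / 2.

Lemma half_ge j : 1 / 2 <= half j.
Proof. unfold half. pose proof (pos_INR j). lra. Qed.

(** Telescoping: each term is at most [8 / (n + 1) - 8 / (n + 2)], so the induction carries the
    stronger bound [8 - 8 / (n + 1)]. *)
Lemma psum_inv_half_sqr n : psum (fun j => / half j ^ 2) n <= 8.
Proof.
  assert (H : psum (fun j => / half j ^ 2) n <= 8 - 8 / (INR n + 1)).
  { induction n as [|n IH]; [simpl; lra|].
    cbn [psum]. rewrite S_INR. pose proof (pos_INR n). unfold half at 2.
    assert (/ (INR n + 1 / 2) ^ 2 <= 8 / ((INR n + 1) * (INR n + 2))).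
    { apply Rle_div_r; [nra|]. apply Rmult_le_reg_l with ((INR n + 1 / 2) ^ 2); [nra|].
      rewrite <- Rmult_assoc, Rinv_r by nra. nra. }
    replace (8 - 8 / (INR n + 1 + 1)) with
      (8 - 8 / (INR n + 1) + 8 / ((INR n + 1) * (INR n + 2))) by (field; lra).
    lra. }
  pose proof (pos_INR n).
  assert (0 <= 8 / (INR n + 1)) by (apply Rdiv_le_0_compat; lra). lra.
Qed.

(** The true growth is logarithmic; a square root is enough and telescopes, since
    [/ half n <= 4 (sqrt (n + 1) - sqrt n)]. *)
Lemma psum_inv_half n : psum (fun j => / half j) n <= 4 * sqrt (INR n).
Proof.
  induction n as [|n IH]; [simpl; rewrite sqrt_0; lra|].
  cbn [psum]. rewrite S_INR. pose proof (pos_INR n).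
  set (a := sqrt (INR n)) in *. set (b := sqrt (INR n + 1)).
  assert (Ha : 0 <= a) by apply sqrt_pos.
  assert (Ea : a * a = INR n) by (apply sqrt_sqrt; lra).
  assert (Eb : b * b = INR n + 1) by (apply sqrt_sqrt; lra).
  assert (Hb : 1 <= b) by (rewrite <- sqrt_1; apply sqrt_le_1_alt; lra).
  assert (Hab : a <= b) by (apply sqrt_le_1_alt; lra).
  enough (/ half n <= 4 * (b - a)) by lra.
  apply Rmult_le_reg_l with (half n); [unfold half; lra|].
  rewrite Rinv_r by (unfold half; lra). unfold half. rewrite <- Ea.
  assert ((b - a) * (b + a) = 1) by nra.
  assert (1 / 2 <= (b - a) * b) by nra.
  assert ((b - a) * b <= (b - a) * (2 * (a * a + 1 / 2))); [|nra].
  apply Rmult_le_compat_l; [lra|]. nra.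
Qed.

Lemma PI_gt_3 : 3 < PI.
Proof. pose proof PI2_3_2. lra. Qed.

Lemma Rabs_neg1_pow j : Rabs ((-1) ^ j) = 1.
Proof. apply pow_1_abs. Qed.

(** Since [PI > 3] and [half j >= 1 / 2], [PI * half j - 1 >= half j]. *)
Lemma pole_ge t j : Rabs t <= 1 -> half j <= pole t j.
Proof.
  intros Ht. unfold pole. change (INR j + 1 / 2) with (half j).
  pose proof PI_gt_3. pose proof (half_ge j).
  assert (Rabs ((-1) ^ j * t) <= 1) as H1 by (rewrite Rabs_mult, Rabs_neg1_pow; lra).
  apply Rabs_le_between in H1. nra.
Qed.

Lemma pole_sub t j : Rabs t <= 1 -> Rabs (pole t j - pole 0 j) <= 1.
Proof.
  intros Ht. unfold pole.
  replace (_ - _ - _) with (- ((-1) ^ j * t)) by ring.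
  rewrite Rabs_Ropp, Rabs_mult, Rabs_neg1_pow. lra.
Qed.

Lemma atan_lipschitz u v : Rabs (atan u - atan v) <= Rabs (u - v).
Proof.
  destruct (MVT_gen atan v u (fun x => / (1 + x ^ 2))) as [c [_ ->]].
  - intros x _. apply is_derive_Reals. apply derivable_pt_lim_atan.
  - intros x _. apply derivable_continuous_pt, derivable_pt_atan.
  - rewrite Rabs_mult. rewrite <- (Rmult_1_l (Rabs (u - v))) at 2.
    apply Rmult_le_compat_r; [apply Rabs_pos|].
    assert (1 <= 1 + c ^ 2) by nra.
    rewrite Rabs_pos_eq by (left; apply Rinv_0_lt_compat; lra).
    rewrite <- Rinv_1. apply Rinv_le_contravar; lra.
Qed.

Lemma Rabs_atan_le u : Rabs (atan u) <= Rabs u.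
Proof.
  pose proof (atan_lipschitz u 0) as H. rewrite atan_0, !Rminus_0_r in H. exact H.
Qed.

Lemma is_RInt_lorentz p a b : 0 < p ->
  is_RInt (fun x => 2 / (x ^ 2 + p ^ 2)) a b (2 / p * (atan (b / p) - atan (a / p))).
Proof.
  intros Hp.
  replace (2 / p * (atan (b / p) - atan (a / p)))
    with (minus (2 / p * atan (b / p)) (2 / p * atan (a / p)))
    by (unfold minus, plus, opp; simpl; ring).
  apply (is_RInt_derive (fun x => 2 / p * atan (x / p)) (fun x => 2 / (x ^ 2 + p ^ 2))).
  - intros x _. auto_derive; [exact I|]. field. split; nra.
  - intros x _. apply continuous_of_ex_derive.
    auto_derive. nra.
Qed.

Lemma Rabs_div_pos n d : 0 < d -> Rabs (n / d) = Rabs n / d.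
Proof. intros Hd. rewrite Rabs_div, (Rabs_pos_eq d) by lra. reflexivity. Qed.

Lemma lorentz_near_zero c p a : 0 < c <= p -> 0 < a ->
  Rabs (2 / p * atan (a / p)) <= 2 * a / c ^ 2.
Proof.
  intros Hc Ha. rewrite Rabs_mult, (Rabs_pos_eq (2 / p)) by (apply Rdiv_le_0_compat; lra).
  apply Rle_trans with (2 / p * (a / p)).
  - apply Rmult_le_compat_l; [apply Rdiv_le_0_compat; lra|].
    eapply Rle_trans; [apply Rabs_atan_le|]. rewrite Rabs_pos_eq; [lra|].
    apply Rdiv_le_0_compat; lra.
  - replace (2 / p * (a / p)) with (2 * a * / p ^ 2) by (field; lra).
    apply Rmult_le_compat_l; [lra|]. apply Rinv_le_contravar; [nra|].
    apply pow_incr; lra.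
Qed.

(** Each term alone is only known to be at most [2 / b], with no decay in the pole; summed over
    [16^m] poles with [b = 8^m], that bound would blow up. The difference gains the factor [/ c]
    because [p] and [q] stay within distance 1. *)
Lemma lorentz_tail c p q b : 0 < c -> 0 < p -> c <= q -> 0 < b -> Rabs (p - q) <= 1 ->
  Rabs (2 / p * atan (p / b) - 2 / q * atan (q / b)) <= 4 / b * / c.
Proof.
  intros Hc Hp Hq Hb Hpq.
  replace (2 / p * atan (p / b) - 2 / q * atan (q / b)) with
    (2 / q * ((q - p) / p * atan (p / b) + (atan (p / b) - atan (q / b))))
    by (field; lra).
  rewrite Rabs_mult, (Rabs_pos_eq (2 / q)) by (apply Rdiv_le_0_compat; lra).
  apply Rle_trans with (2 / q * (2 / b)).
  - apply Rmult_le_compat_l; [apply Rdiv_le_0_compat; lra|].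
    eapply Rle_trans; [apply Rabs_triang|].
    replace (2 / b) with (1 / b + 1 / b) by (field; lra).
    apply Rplus_le_compat.
    + rewrite Rabs_mult, Rabs_div_pos, Rabs_minus_sym by lra.
      apply Rle_trans with (1 / p * (p / b)); [|right; field; lra].
      apply Rmult_le_compat; try apply Rabs_pos.
      * apply Rdiv_le_0_compat; [apply Rabs_pos|lra].
      * apply Rmult_le_compat_r; [left; apply Rinv_0_lt_compat; lra|lra].
      * eapply Rle_trans; [apply Rabs_atan_le|].
        rewrite Rabs_pos_eq; [lra|apply Rdiv_le_0_compat; lra].
    + eapply Rle_trans; [apply atan_lipschitz|].
      replace (p / b - q / b) with ((p - q) / b) by (field; lra).
      rewrite Rabs_div_pos by lra.
      apply Rmult_le_compat_r; [left; apply Rinv_0_lt_compat; lra|lra].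
  - replace (2 / q * (2 / b)) with (4 / b * / q) by (field; lra).
    apply Rmult_le_compat_l; [apply Rdiv_le_0_compat; lra|].
    apply Rinv_le_contravar; lra.
Qed.

(** Writing [atan (b / r) = PI / 2 - atan (r / b)] isolates the full integrals [PI / p] and
    [PI / q]; what remains is the tail beyond [b] and the piece below [a]. *)
Lemma lorentz_diff c p q a b :
  0 < c -> c <= p -> c <= q -> 0 < a -> 0 < b -> Rabs (p - q) <= 1 ->
  Rabs (2 / p * (atan (b / p) - atan (a / p)) - 2 / q * (atan (b / q) - atan (a / q))
        - (PI / p - PI / q)) <= 4 / b * / c + 4 * a * / c ^ 2.
Proof.
  intros Hc Hp Hq Ha Hb Hpq.
  assert (E : forall r, 0 < r -> atan (b / r) = PI / 2 - atan (r / b)).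
  { intros r Hr. rewrite <- atan_inv by (apply Rdiv_lt_0_compat; lra).
    f_equal. field. lra. }
  rewrite !E by lra.
  replace (_ - _ - _) with
    (- (2 / p * atan (p / b) - 2 / q * atan (q / b))
     + (- (2 / p * atan (a / p)) + 2 / q * atan (a / q))) by (field; lra).
  pose proof (lorentz_tail c p q b Hc ltac:(lra) Hq Hb Hpq).
  pose proof (lorentz_near_zero c p a ltac:(lra) Ha).
  pose proof (lorentz_near_zero c q a ltac:(lra) Ha).
  eapply Rle_trans; [apply Rabs_triang|]. rewrite Rabs_Ropp.
  apply Rplus_le_compat; [assumption|].
  eapply Rle_trans; [apply Rabs_triang|]. rewrite Rabs_Ropp.
  unfold Rdiv in *. lra.
Qed.

Lemma is_RInt_psum (f : nat -> R -> R) (l : nat -> R) a b n :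
  (forall j, (j < n)%nat -> is_RInt (f j) a b (l j)) ->
  is_RInt (fun x => psum (fun j => f j x) n) a b (psum l n).
Proof.
  induction n as [|n IH]; intros H; simpl.
  - pose proof (is_RInt_const (V:=R_NormedModule) a b 0) as H0.
    change (scal (b - a) 0) with ((b - a) * 0) in H0. rewrite Rmult_0_r in H0. exact H0.
  - apply (is_RInt_plus (V:=R_NormedModule)); [apply IH; intros; apply H; lia|apply H; lia].
Qed.

(* Cutting the integral at [(1/2)^m] and [8^m] while keeping [16^m] terms makes
   all errors, the harmonic-type one included, [O((1/2)^m)]. *)
Lemma kern_integral_approx m t I : Rabs t <= 1 ->
  is_RInt (fun x => (kern x t - kern x 0) / x) ((1 / 2) ^ m) (8 ^ m) I ->
  Rabs (I - psum (fun j => PI / pole t j - PI / pole 0 j) (2 ^ (4 * m)))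
    <= 84 * (1 / 2) ^ m.
Proof.
  intros Ht HI. set (a := (1 / 2) ^ m) in *. set (b := 8 ^ m) in *.
  set (N := (2 ^ (4 * m))%nat).
  assert (Hab : 0 < a <= 1).
  { unfold a. split; [apply pow_lt; lra|]. apply Rle_trans with (1 ^ m); [apply pow_incr; lra|rewrite pow1; lra]. }
  assert (Hb : 1 <= b) by (apply pow_R1_Rle; lra).
  assert (HN : 2 ^ (4 * m) = b / a).
  { unfold a, b. rewrite pow_mult. replace (2 ^ 4) with (8 / (1 / 2)) by field.
    unfold Rdiv at 1. rewrite Rpow_mult_distr, pow_inv. reflexivity. }
  (* Every [x] in [[a, b]] thus satisfies [x <= 2 ^ (4 * m)], as the partial fractions require. *)
  assert (HNb : b <= b / a) by (apply Rle_div_r; nra).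
  assert (HsN : sqrt (INR N) = b * a).
  { apply sqrt_lem_1; [apply pos_INR|nra|]. unfold N. rewrite pow_INR. simpl (INR 2).
    replace (1 + 1) with 2 by ring. unfold a, b. rewrite <- Rpow_mult_distr, <- Rpow_mult_distr, pow_mult.
    f_equal. simpl. field. }
  pose (T := fun p => 2 / p * (atan (b / p) - atan (a / p))).
  assert (HS : is_RInt (fun x => psum (fun j => 2 / (x ^ 2 + pole t j ^ 2)
                 + -1 * (2 / (x ^ 2 + pole 0 j ^ 2))) N) a b
               (psum (fun j => T (pole t j) + -1 * T (pole 0 j)) N)).
  { apply (is_RInt_psum (fun j x => 2 / (x ^ 2 + pole t j ^ 2)
                 + -1 * (2 / (x ^ 2 + pole 0 j ^ 2)))). intros j _.
    pose proof (half_ge j). pose proof (pole_ge t j Ht).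
    pose proof (pole_ge 0 j ltac:(rewrite Rabs_R0; lra)).
    apply (is_RInt_plus (V:=R_NormedModule)); [apply is_RInt_lorentz; lra|].
    apply (is_RInt_scal (V:=R_NormedModule)), is_RInt_lorentz; lra. }
  (* Two kernels, each with error [18 x a / b], divided by [x] and integrated over a length
     [b - a]. *)
  assert (H1 : Rabs (I - psum (fun j => T (pole t j) + -1 * T (pole 0 j)) N) <= (b - a) * (36 * (a / b))).
  { refine (norm_RInt_le_const (V:=R_NormedModule) _ a b _ _ _ _
      (is_RInt_minus _ _ _ _ _ _ HI HS)); [lra|]. intros x Hx.
    change (Rabs ((kern x t - kern x 0) / x -
      psum (fun j => 2 / (x ^ 2 + pole t j ^ 2) + -1 * (2 / (x ^ 2 + pole 0 j ^ 2))) N)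
      <= 36 * (a / b)).
    pose proof PI_gt_3. apply Rabs_le_between in Ht.
    pose proof (kern_partial_fractions (4 * m) x t ltac:(lra) ltac:(lra)) as K1.
    pose proof (kern_partial_fractions (4 * m) x 0 ltac:(lra) ltac:(lra)) as K2.
    fold N in K1, K2. rewrite HN in K1, K2.
    assert (Ex : forall u, psum (fun j => 2 * x / (x ^ 2 + pole u j ^ 2)) N
                = x * psum (fun j => 2 / (x ^ 2 + pole u j ^ 2)) N).
    { intros u. rewrite <- psum_scal. apply psum_ext. intros; unfold Rdiv; ring. }
    rewrite Ex in K1, K2. rewrite psum_plus, psum_scal.
    set (s1 := psum (fun j => 2 / (x ^ 2 + pole t j ^ 2)) N) in *.
    set (s2 := psum (fun j => 2 / (x ^ 2 + pole 0 j ^ 2)) N) in *.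
    replace (_ - (s1 + -1 * s2)) with
      (((kern x t - x * s1) - (kern x 0 - x * s2)) / x) by (field; lra).
    rewrite Rabs_div_pos by lra. apply Rle_div_l; [lra|].
    eapply Rle_trans; [apply Rabs_triang|]. rewrite Rabs_Ropp.
    replace (36 * (a / b) * x) with (18 * x / (b / a) + 18 * x / (b / a)) by (field; lra).
    lra. }
  assert (H2 : Rabs (psum (fun j => T (pole t j) + -1 * T (pole 0 j)) N
      - psum (fun j => PI / pole t j - PI / pole 0 j) N)
      <= 4 / b * (4 * (b * a)) + 4 * a * 8).
  { replace (_ - _) with (psum (fun j => (T (pole t j) + -1 * T (pole 0 j))
      + -1 * (PI / pole t j - PI / pole 0 j)) N) by (rewrite (psum_plus _ (fun j => -1 * _)), psum_scal; ring).
    eapply Rle_trans; [apply Rabs_psum|].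
    eapply Rle_trans; [apply (psum_le _ (fun j => 4 / b * / half j + 4 * a * / half j ^ 2))|].
    - intros j _. pose proof (half_ge j).
      replace (T (pole t j) + -1 * T (pole 0 j) + -1 * (PI / pole t j - PI / pole 0 j))
        with (T (pole t j) - T (pole 0 j) - (PI / pole t j - PI / pole 0 j)) by ring.
      apply lorentz_diff; try lra; [apply pole_ge, Ht|apply pole_ge; rewrite Rabs_R0; lra
       |apply pole_sub, Ht].
    - rewrite psum_plus, !psum_scal. apply Rplus_le_compat.
      + apply Rmult_le_compat_l; [apply Rdiv_le_0_compat; lra|].
        rewrite <- HsN. apply psum_inv_half.
      + apply Rmult_le_compat_l; [lra|]. apply psum_inv_half_sqr. }
  assert (H3 : (b - a) * (36 * (a / b)) <= 36 * a).
  { replace (36 * a) with (b * (36 * (a / b))) by (field; lra).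
    apply Rmult_le_compat_r; [|lra]. assert (0 <= a / b) by (apply Rdiv_le_0_compat; lra). lra. }
  (* The tails give [16 a], the pieces near 0 give [32 a]; with [36 a] from the kernels the total is
     [84 a]. *)
  replace (4 / b * (4 * (b * a)) + 4 * a * 8) with (48 * a) in H2 by (field; lra).
  set (s1 := psum (fun j => T _ + _) N) in *. set (s2 := psum (fun j => PI / _ - _) N) in *.
  replace (I - s2) with ((I - s1) + (s1 - s2)) by ring.
  eapply Rle_trans; [apply Rabs_triang|]. lra.
Qed.

(** * Expansion of the pole sum in powers of [t] *)

(* [lerch_coef s] is [Phi((-1)^s, s+1, 1/2) / PI^s]; the defining series
   diverges at [s = 0], where the value is junk. *)
Definition lerch_coef (s : nat) : R :=
  Series (fun j => ((-1) ^ j) ^ s / half j ^ S s) / PI ^ s.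

Lemma inv_pow_half_le j s : / half j ^ (s + 2) <= 2 ^ s * / half j ^ 2.
Proof.
  pose proof (half_ge j).
  rewrite pow_add, Rinv_mult. apply Rmult_le_compat_r.
  - left. apply Rinv_0_lt_compat, pow_lt. lra.
  - rewrite <- pow_inv. apply pow_incr. split; [left; apply Rinv_0_lt_compat; lra|].
    replace 2 with (/ (1 / 2)) by field. apply Rinv_le_contravar; lra.
Qed.

Lemma ex_series_inv_half_sqr : ex_series (fun j => / half j ^ 2).
Proof.
  destruct (ex_finite_lim_seq_incr (fun n => sum_n (fun j => / half j ^ 2) n) 8) as [l Hl].
  - intros n. rewrite sum_Sn. pose proof (half_ge (S n)).
    assert (0 < / half (S n) ^ 2) by (apply Rinv_0_lt_compat, pow_lt; lra).
    unfold plus; simpl. simpl in *. lra.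
  - intros n. rewrite sum_n_psum. apply psum_inv_half_sqr.
  - exists l. exact Hl.
Qed.

Lemma is_lim_seq_psum f : ex_series f -> is_lim_seq (psum f) (Series f).
Proof.
  intros H. apply is_lim_seq_incr_1.
  apply is_lim_seq_ext with (sum_n f); [intros; apply sum_n_psum|].
  apply Series_correct, H.
Qed.

Lemma lerch_coef_lim s :
  is_lim_seq (fun n => psum (fun j => ((-1) ^ j) ^ S s / half j ^ S (S s)) n / PI ^ S s)
    (lerch_coef (S s)).
Proof.
  apply (is_lim_seq_scal_r _ (/ PI ^ S s) (Finite _)).
  apply is_lim_seq_psum.
  apply (ex_series_le (K:=R_AbsRing) (V:=R_CompleteNormedModule)) with (fun j => 2 ^ s * / half j ^ 2).
  - intros j. change (Rabs (((-1) ^ j) ^ S s / half j ^ S (S s)) <= 2 ^ s * / half j ^ 2).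
    pose proof (half_ge j).
    rewrite Rabs_div_pos by (apply pow_lt; lra).
    rewrite <- RPow_abs, Rabs_neg1_pow, pow1. unfold Rdiv. rewrite Rmult_1_l.
    replace (S (S s)) with (s + 2)%nat by lia. apply inv_pow_half_le.
  - apply (ex_series_scal (K:=R_AbsRing) (V:=R_NormedModule)), ex_series_inv_half_sqr.
Qed.

(** The finite geometric series with its exact remainder. It serves both expansions: with
    [c = half j] for powers of [t], and with [c = cosh x] for powers of [sin t]. *)
Lemma geometric_expansion c u K : 0 < c -> u < c ->
  / (c - u) - / c - psum (fun s => u ^ S s / c ^ S (S s)) K
  = u ^ S K / (c ^ S K * (c - u)).
Proof.
  intros Hc Hu. induction K as [|K IH].
  - simpl. field. lra.
  - cbn [psum].
    replace (/ (c - u) - / c - _) with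
      (/ (c - u) - / c - psum (fun s => u ^ S s / c ^ S (S s)) K - u ^ S K / c ^ S (S K)) by ring.
    rewrite IH. assert (c ^ K <> 0) by (apply pow_nonzero; lra). simpl. field. lra.
Qed.

(** With [u = (-1)^j t / PI], [PI > 3] gives [|u| <= 1 / 3], hence [half j - u >= half j / 3]: this
    is the factor 3. The factor [2 ^ K] pays for reducing [/ half j ^ (K + 2)] to the summable
    [/ half j ^ 2]. *)
Lemma pole_expansion t j K : Rabs t <= 1 ->
  Rabs (PI / pole t j - PI / pole 0 j
        - psum (fun s => (t / PI) ^ S s * (((-1) ^ j) ^ S s / half j ^ S (S s))) K)
  <= 3 * 2 ^ K * Rabs t ^ S K * / half j ^ 2.
Proof.
  intros Ht. pose proof PI_gt_3. pose proof (half_ge j).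
  set (u := (-1) ^ j * (t / PI)).
  assert (Hut : Rabs u <= Rabs t / 3).
  { unfold u. rewrite Rabs_mult, Rabs_neg1_pow, Rmult_1_l, Rabs_div_pos by lra.
    apply Rmult_le_compat_l; [apply Rabs_pos|]. apply Rinv_le_contravar; lra. }
  pose proof (Rabs_pos t). pose proof (Rle_abs u).
  assert (E1 : pole t j = PI * (half j - u)) by (unfold pole, u, half; field; lra).
  assert (E0 : pole 0 j = PI * half j) by (unfold pole, half; ring).
  replace (PI / pole t j - PI / pole 0 j) with (/ (half j - u) - / half j)
    by (rewrite E1, E0; field; lra).
  rewrite (psum_ext _ (fun s => u ^ S s / half j ^ S (S s)))
    by (intros; unfold u, Rdiv; rewrite (Rpow_mult_distr ((-1) ^ j)); ring).
  rewrite geometric_expansion by lra.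
  assert (0 < half j ^ S K) by (apply pow_lt; lra).
  rewrite Rabs_div_pos by (apply Rmult_lt_0_compat; lra).
  rewrite <- RPow_abs. unfold Rdiv.
  apply Rle_trans with (Rabs t ^ S K * (3 * / half j ^ (K + 2))).
  - apply Rmult_le_compat.
    + apply pow_le, Rabs_pos.
    + left. apply Rinv_0_lt_compat, Rmult_lt_0_compat; lra.
    + apply pow_incr. split; [apply Rabs_pos|lra].
    + replace (3 * / half j ^ (K + 2)) with (/ (half j ^ S K * (half j / 3))).
      * apply Rinv_le_contravar; [apply Rmult_lt_0_compat; lra|].
        apply Rmult_le_compat_l; lra.
      * replace (K + 2)%nat with (S (S K)) by lia. rewrite <- (tech_pow_Rmult (half j) (S K)).
        field. lra.
  - replace (3 * 2 ^ K * Rabs t ^ S K * / half j ^ 2)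
      with (Rabs t ^ S K * (3 * (2 ^ K * / half j ^ 2))) by ring.
    apply Rmult_le_compat_l; [apply pow_le, Rabs_pos|].
    apply Rmult_le_compat_l; [lra|]. apply inv_pow_half_le.
Qed.

Lemma psum_exchange (f : nat -> nat -> R) m n :
  psum (fun i => psum (f i) n) m = psum (fun j => psum (fun i => f i j) m) n.
Proof.
  induction m as [|m IH]; simpl.
  - induction n as [|n IHn]; simpl; [reflexivity|rewrite <- IHn; ring].
  - rewrite IH, <- psum_plus. reflexivity.
Qed.

(** The bound does not depend on [n], so it survives the limit over the number of poles;
    [24 = 3 * 8], with 8 from [psum_inv_half_sqr]. *)
Lemma pole_sum_expansion t n K : Rabs t <= 1 ->
  Rabs (psum (fun j => PI / pole t j - PI / pole 0 j) n
        - psum (fun s => psum (fun j => ((-1) ^ j) ^ S s / half j ^ S (S s)) n / PI ^ S s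
                         * t ^ S s) K)
  <= 24 * 2 ^ K * Rabs t ^ S K.
Proof.
  intros Ht.
  assert (E : psum (fun s => psum (fun j => ((-1) ^ j) ^ S s / half j ^ S (S s)) n / PI ^ S s
                         * t ^ S s) K
   = psum (fun j => psum (fun s => (t / PI) ^ S s * (((-1) ^ j) ^ S s / half j ^ S (S s))) K) n).
  { rewrite psum_exchange. apply psum_ext. intros s _.
    rewrite psum_scal. unfold Rdiv at 2 3. rewrite Rpow_mult_distr, pow_inv. unfold Rdiv. ring. }
  rewrite E.
  replace (_ - _) with (psum (fun j => (PI / pole t j - PI / pole 0 j) + -1 *
    psum (fun s => (t / PI) ^ S s * (((-1) ^ j) ^ S s / half j ^ S (S s))) K) n)
    by (rewrite (psum_plus _ (fun j => -1 * _)), psum_scal; ring).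
  eapply Rle_trans; [apply Rabs_psum|].
  eapply Rle_trans; [apply (psum_le _ (fun j => 3 * 2 ^ K * Rabs t ^ S K * / half j ^ 2))|].
  - intros j _. eapply Rle_trans; [|apply pole_expansion, Ht]. right. f_equal. ring.
  - rewrite psum_scal. pose proof (psum_inv_half_sqr n).
    assert (0 <= 3 * 2 ^ K * Rabs t ^ S K).
    { pose proof (pow_lt 2 K ltac:(lra)). pose proof (pow_le (Rabs t) (S K) (Rabs_pos t)). 
      apply Rmult_le_pos; lra. }
    nra.
Qed.

Lemma is_lim_seq_finite_psum (u : nat -> nat -> R) (l : nat -> R) K :
  (forall s, (s < K)%nat -> is_lim_seq (fun n => u n s) (l s)) ->
  is_lim_seq (fun n => psum (u n) K) (psum l K).
Proof.
  induction K as [|K IH]; intros H; simpl; [apply is_lim_seq_const|].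
  apply is_lim_seq_plus'; [apply IH; intros; apply H; lia|apply H; lia].
Qed.

(** The inequality for the [m]-th cutoff has error [84 (1/2)^m] plus the fixed remainder in [t];
    letting [m] grow with [K] fixed removes the first. *)
Lemma kern_integral_expansion t F K : Rabs t <= 1 ->
  (forall a b, 0 < a -> 0 < b -> ex_RInt (fun x => (kern x t - kern x 0) / x) a b) ->
  int0oo (fun x => (kern x t - kern x 0) / x) F ->
  Rabs (F - psum (fun s => lerch_coef (S s) * t ^ S s) K) <= 24 * 2 ^ K * Rabs t ^ S K.
Proof.
  intros Ht Hex HF.
  set (f := fun x => (kern x t - kern x 0) / x) in *.
  pose (I := fun m => RInt f ((1 / 2) ^ m) (8 ^ m)).
  assert (HI : forall m, is_RInt f ((1 / 2) ^ m) (8 ^ m) (I m)).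
  { intros m. apply (RInt_correct f), Hex; apply pow_lt; lra. }
  assert (Hhalf : is_lim_seq (fun m => (1 / 2) ^ m) 0)
    by (apply is_lim_seq_geom; rewrite Rabs_pos_eq; lra).
  assert (HIF : is_lim_seq I F).
  { apply int0oo_seq with f (fun m => (1 / 2) ^ m) (fun m => 8 ^ m); auto.
    - intros m. apply pow_lt; lra.
    - apply is_lim_seq_geom_p. lra. }
  assert (Hsub : filterlim (fun m => (2 ^ (4 * m))%nat) eventually eventually).
  { apply eventually_subseq. intros m. apply Nat.pow_lt_mono_r; lia. }
  pose (S0 := fun n s => psum (fun j => ((-1) ^ j) ^ S s / half j ^ S (S s)) n / PI ^ S s
                         * t ^ S s).
  assert (HS : is_lim_seq (fun m => psum (S0 (2 ^ (4 * m))%nat) K)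
                 (psum (fun s => lerch_coef (S s) * t ^ S s) K)).
  { apply is_lim_seq_finite_psum. intros s _.
    apply (is_lim_seq_scal_r _ (t ^ S s) (Finite _)).
    apply (is_lim_seq_subseq _ _ _ Hsub (lerch_coef_lim s)). }
  pose proof (is_lim_seq_abs _ _ (is_lim_seq_minus' _ _ _ _ HIF HS)) as HL.
  pose proof (is_lim_seq_plus' _ _ _ _ (is_lim_seq_scal_l _ 84 _ Hhalf)
     (is_lim_seq_const (24 * 2 ^ K * Rabs t ^ S K))) as HR.
  assert (Hle : forall m, Rabs (I m - psum (S0 (2 ^ (4 * m))%nat) K)
     <= 84 * (1 / 2) ^ m + 24 * 2 ^ K * Rabs t ^ S K).
  { intros m. set (N := (2 ^ (4 * m))%nat).
    pose proof (kern_integral_approx m t (I m) Ht (HI m)) as H1.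
    pose proof (pole_sum_expansion t N K Ht) as H2. fold N in H1.
    replace (I m - psum (S0 N) K) with
      ((I m - psum (fun j => PI / pole t j - PI / pole 0 j) N)
       + (psum (fun j => PI / pole t j - PI / pole 0 j) N - psum (S0 N) K)) by ring.
    eapply Rle_trans; [apply Rabs_triang|]. apply Rplus_le_compat; assumption. }
  pose proof (is_lim_seq_le _ _ _ _ Hle HL HR) as H. simpl in H. rewrite Rmult_0_r, Rplus_0_l in H.
  exact H.
Qed.

(** * Expansion in powers of the sine *)

Lemma inv_cosh_le x : / cosh x <= 2 * exp (- x).
Proof.
  rewrite exp_Ropp. pose proof (exp_pos x). pose proof (cosh_ge_exp x).
  replace (2 * / exp x) with (/ (exp x / 2)) by (field; lra).
  apply Rinv_le_contravar; lra.
Qed.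

(** [sinh x <= x cosh x] cancels the [x] in the denominator, leaving [2 / cosh x <= 4 exp (- x)]. *)
Lemma sinh_div_bound x D : 0 < x -> cosh x ^ 2 / 2 <= D ->
  Rabs (sinh x / (x * D)) <= 4 * exp (- x).
Proof.
  intros Hx HD. pose proof (cosh_ge_1 x). pose proof (sinh_ge x ltac:(lra)).
  pose proof (sinh_le_x_cosh x ltac:(lra)).
  assert (HDp : 0 < D) by nra.
  rewrite Rabs_pos_eq by (apply Rdiv_le_0_compat; [lra|apply Rmult_lt_0_compat; lra]).
  apply Rle_trans with (2 * / cosh x); [|pose proof (inv_cosh_le x); lra].
  apply Rle_div_l; [apply Rmult_lt_0_compat; lra|].
  apply Rle_trans with (2 * / cosh x * (x * (cosh x ^ 2 / 2))).
  - replace (2 * / cosh x * (x * (cosh x ^ 2 / 2))) with (x * cosh x) by (field; lra). lra.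
  - apply Rmult_le_compat_l; [apply Rmult_le_pos; [lra|left; apply Rinv_0_lt_compat; lra]|].
    apply Rmult_le_compat_l; lra.
Qed.

Lemma cosh_pow_ge x m : cosh x ^ 2 <= cosh x ^ (m + 2).
Proof. apply Rle_pow; [apply cosh_ge_1|lia]. Qed.

Lemma sinh_cosh_pow_integrable m :
  exists l, int0oo (fun x => sinh x / (x * cosh x ^ (m + 2))) l.
Proof.
  destruct (dominated_is_RInt_gen 4 (fun x => sinh x / (x * cosh x ^ (m + 2)))) as [l [Hl _]];
    [split|].
  - intros x Hx. apply continuous_of_ex_derive.
    pose proof (cosh_ge_1 x). pose proof (pow_lt (cosh x) (m + 2) ltac:(lra)).
    auto_derive. apply Rgt_not_eq, Rmult_lt_0_compat; lra.
  - intros x Hx. apply sinh_div_bound; [exact Hx|].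
    pose proof (cosh_pow_ge x m). pose proof (pow2_ge_0 (cosh x)). lra.
  - exists l. exact Hl.
Qed.

(* The exponent is shifted by 2 since the integral diverges for [cosh x ^ 1]. *)
Definition sinh_cosh_int (m : nat) : R :=
  RInt_gen (fun x => sinh x / (x * cosh x ^ (m + 2))) (at_right 0) (Rbar_locally p_infty).

Lemma sinh_cosh_int_correct m :
  int0oo (fun x => sinh x / (x * cosh x ^ (m + 2))) (sinh_cosh_int m).
Proof.
  destruct (sinh_cosh_pow_integrable m) as [l Hl]. unfold sinh_cosh_int.
  rewrite (is_RInt_gen_unique _ _ Hl). exact Hl.
Qed.

(** The restriction on [z] gives [cosh x - z >= cosh x / 2], so the bound 4 is uniform in [z] and
    [K]. *)
Lemma sinh_cosh_remainder_integrable z K : Rabs z <= 1 / 2 ->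
  exists l, int0oo (fun x => sinh x / (x * (cosh x ^ S K * (cosh x - z)))) l /\ Rabs l <= 4.
Proof.
  intros Hz. apply Rabs_le_between in Hz. apply dominated_is_RInt_gen. split.
  - intros x Hx. apply continuous_of_ex_derive.
    pose proof (cosh_ge_1 x). pose proof (pow_lt (cosh x) (S K) ltac:(lra)).
    auto_derive. apply Rgt_not_eq, Rmult_lt_0_compat; [lra|].
    apply Rmult_lt_0_compat; [assumption|lra].
  - intros x Hx. apply sinh_div_bound; [exact Hx|].
    pose proof (cosh_ge_1 x). pose proof (Rle_pow (cosh x) 1 (S K) ltac:(lra) ltac:(lia)).
    rewrite pow_1 in *. replace (cosh x ^ 2 / 2) with (cosh x * (cosh x / 2)) by field.
    apply Rmult_le_compat; lra.
Qed.

Lemma kern_geometric t x K : 0 < x ->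
  (kern x t - kern x 0) / x =
  psum (fun i => sin t ^ S i * (sinh x / (x * cosh x ^ (i + 2)))) K
  + sin t ^ S K * (sinh x / (x * (cosh x ^ S K * (cosh x - sin t)))).
Proof.
  intros Hx. pose proof (cosh_gt_1 x Hx). pose proof (cosh_sub_sin_pos x t Hx).
  pose proof (geometric_expansion (cosh x) (sin t) K ltac:(lra) ltac:(lra)) as H1.
  unfold kern. rewrite sin_0.
  rewrite (psum_ext (fun i => sin t ^ S i * (sinh x / (x * cosh x ^ (i + 2))))
    (fun s => sinh x / x * (sin t ^ S s / cosh x ^ S (S s)))).
  - rewrite psum_scal.
    assert (cosh x ^ S K <> 0) by (apply pow_nonzero; lra).
    replace (sin t ^ S K * (sinh x / (x * (cosh x ^ S K * (cosh x - sin t)))))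
      with (sinh x / x * (sin t ^ S K / (cosh x ^ S K * (cosh x - sin t)))) by (field; lra).
    rewrite <- H1. field. lra.
  - intros i _. replace (i + 2)%nat with (S (S i)) by lia.
    assert (cosh x ^ S (S i) <> 0) by (apply pow_nonzero; lra).
    field. lra.
Qed.

(** Two finite expansions of the same integral, in powers of [sin t] and of [t]. At [t = asin z]
    both remainders are [O(z^(K+1))]. *)
Lemma sinh_cosh_int_expansion t K : Rabs t <= 1 -> Rabs (sin t) <= 1 / 2 ->
  Rabs (psum (fun i => sin t ^ S i * sinh_cosh_int i) K
        - psum (fun s => lerch_coef (S s) * t ^ S s) K)
  <= 24 * 2 ^ K * Rabs t ^ S K + 4 * Rabs (sin t) ^ S K.
Proof.
  intros Ht Hz. destruct (sinh_cosh_remainder_integrable (sin t) K Hz) as [l [Hl Hl4]].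
  assert (HF : int0oo (fun x => (kern x t - kern x 0) / x)
    (psum (fun i => sin t ^ S i * sinh_cosh_int i) K + sin t ^ S K * l)).
  { apply int0oo_ext with (fun x =>
      psum (fun i => sin t ^ S i * (sinh x / (x * cosh x ^ (i + 2)))) K
      + sin t ^ S K * (sinh x / (x * (cosh x ^ S K * (cosh x - sin t))))).
    - intros x Hx. symmetry. apply kern_geometric, Hx.
    - apply int0oo_plus; [|apply int0oo_scal, Hl].
      apply (int0oo_psum (fun i x => sin t ^ S i * (sinh x / (x * cosh x ^ (i + 2))))).
      intros i _. apply int0oo_scal, sinh_cosh_int_correct. }
  apply kern_integral_expansion with (K := K) in HF; [|exact Ht|].
  - assert (H : Rabs (sin t ^ S K * l) <= 4 * Rabs (sin t) ^ S K).
    { rewrite Rabs_mult, <- RPow_abs, Rmult_comm.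
      apply Rmult_le_compat_r; [apply pow_le, Rabs_pos|exact Hl4]. }
    set (s1 := psum _ K) in *. set (s2 := psum (fun s => lerch_coef _ * _) K) in *.
    replace (s1 - s2) with ((s1 + sin t ^ S K * l - s2) + - (sin t ^ S K * l)) by ring.
    eapply Rle_trans; [apply Rabs_triang|]. rewrite Rabs_Ropp. lra.
  - intros a b Ha Hb. apply (ex_RInt_continuous (V:=R_CompleteNormedModule)).
    intros x Hx. pose proof (Rmin_glb_lt a b 0 Ha Hb).
    apply continuous_of_ex_derive. unfold kern.
    pose proof (cosh_sub_sin_pos x t ltac:(lra)). pose proof (cosh_sub_sin_pos x 0 ltac:(lra)).
    auto_derive. repeat split; try lra; apply Rgt_not_eq; lra.
Qed.

(** * Taylor coefficients at the origin *)

(* Closed under differentiation on (-1, 1), hence all members are smooth there. *)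
Inductive elem : (R -> R) -> Prop :=
| elem_const c : elem (fun _ => c)
| elem_id : elem (fun z => z)
| elem_asin : elem asin
| elem_invsqrt : elem (fun z => / sqrt (1 - z ^ 2))
| elem_plus f g : elem f -> elem g -> elem (fun z => f z + g z)
| elem_mult f g : elem f -> elem g -> elem (fun z => f z * g z).

Lemma elem_pow f n : elem f -> elem (fun z => f z ^ n).
Proof.
  intros Hf. induction n as [|n IH]; [exact (elem_const 1)|].
  exact (elem_mult _ _ Hf IH).
Qed.

Lemma elem_psum (f : nat -> R -> R) n :
  (forall i, (i < n)%nat -> elem (f i)) -> elem (fun z => psum (fun i => f i z) n).
Proof.
  induction n as [|n IH]; intros H; [exact (elem_const 0)|].
  exact (elem_plus _ _ (IH (fun i Hi => H i ltac:(lia))) (H n ltac:(lia))).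
Qed.

Lemma is_derive_asin x : -1 < x < 1 -> is_derive asin x (/ sqrt (1 - x ^ 2)).
Proof.
  intros Hx. apply is_derive_Reals.
  replace (/ sqrt (1 - x ^ 2)) with (derive_pt asin x (derivable_pt_asin x Hx)).
  - apply derive_pt_eq_1 with (derivable_pt_asin x Hx). reflexivity.
  - rewrite derive_pt_asin. unfold Rdiv, Rsqr. rewrite Rmult_1_l. do 3 f_equal. ring.
Qed.

Lemma elem_derive f : elem f ->
  exists g, elem g /\ forall x, -1 < x < 1 -> is_derive f x (g x).
Proof.
  intros Hf.
  induction Hf as [c| | | |f g Hf [f' [Hf' Df]] Hg [g' [Hg' Dg]]|f g Hf [f' [Hf' Df]] Hg [g' [Hg' Dg]]].
  - exists (fun _ => 0). split; [constructor|]. intros x _. auto_derive; auto.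
  - exists (fun _ => 1). split; [constructor|]. intros x _. auto_derive; auto.
  - exists (fun z => / sqrt (1 - z ^ 2)). split; [constructor|apply is_derive_asin].
  - exists (fun z => z * (/ sqrt (1 - z ^ 2)) ^ 3). split.
    + apply (elem_mult (fun z => z)); [constructor|]. apply (elem_pow (fun z => / sqrt (1 - z ^ 2))). constructor.
    + intros x Hx. assert (H0 : 0 < 1 - x ^ 2) by nra.
      pose proof (sqrt_lt_R0 _ H0).
      auto_derive; replace (1 + - (x * (x * 1))) with (1 - x ^ 2) by ring;
        [repeat split; lra|].
      field. lra.
  - exists (fun z => f' z + g' z). split; [constructor; assumption|].
    intros x Hx. exact (is_derive_plus f g x _ _ (Df x Hx) (Dg x Hx)).
  - exists (fun z => f' z * g z + f z * g' z).
    split; [apply (elem_plus (fun z => f' z * g z) (fun z => f z * g' z)); constructor; assumption|].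
    intros x Hx. exact (is_derive_mult f g x _ _ (Df x Hx) (Dg x Hx) Rmult_comm).
Qed.

Lemma locally_unit x : -1 < x < 1 -> locally x (fun y => -1 < y < 1).
Proof.
  intros Hx. assert (Hd : 0 < Rmin (x + 1) (1 - x)) by (apply Rmin_glb_lt; lra).
  exists (mkposreal _ Hd). intros y Hy.
  change (Rabs (y - x) < Rmin (x + 1) (1 - x)) in Hy.
  pose proof (Rmin_l (x + 1) (1 - x)). pose proof (Rmin_r (x + 1) (1 - x)).
  apply Rabs_def2 in Hy. lra.
Qed.

Lemma elem_Derive_n f n : elem f ->
  exists g, elem g /\ forall x, -1 < x < 1 -> Derive_n f n x = g x.
Proof.
  intros Hf. induction n as [|n [g [Hg E]]]; [exists f; auto|].
  destruct (elem_derive g Hg) as [g' [Hg' D]]. exists g'. split; [exact Hg'|].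
  intros x Hx. simpl. rewrite (Derive_ext_loc _ g).
  - apply is_derive_unique, D, Hx.
  - generalize (locally_unit x Hx). apply filter_imp. exact E.
Qed.

Lemma elem_ex_derive_n f n x : elem f -> -1 < x < 1 -> ex_derive_n f n x.
Proof.
  intros Hf Hx. destruct n as [|n]; [exact I|]. simpl.
  destruct (elem_Derive_n f n Hf) as [g [Hg E]].
  destruct (elem_derive g Hg) as [g' [_ D]].
  apply (ex_derive_ext_loc g); [|exists (g' x); apply D, Hx].
  generalize (locally_unit x Hx). apply filter_imp. intros y Hy. symmetry. apply E, Hy.
Qed.

Lemma elem_locally_ex_derive_n f n x : elem f -> -1 < x < 1 ->
  locally x (fun y => forall k, (k <= n)%nat -> ex_derive_n f k y).
Proof.
  intros Hf Hx. generalize (locally_unit x Hx). apply filter_imp.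
  intros y Hy k _. apply elem_ex_derive_n; assumption.
Qed.

(** One side is enough: the behaviour for [z > 0] already determines the Taylor coefficients of a
    smooth function, and [z ^ m] is positive there. *)
Definition right_bigO (m : nat) (f : R -> R) : Prop :=
  exists B d, 0 < d /\ forall z, 0 < z < d -> Rabs (f z) <= B * z ^ m.

Lemma right_bigO_plus m f g : right_bigO m f -> right_bigO m g ->
  right_bigO m (fun z => f z + g z).
Proof.
  intros [B [d [Hd H]]] [B' [d' [Hd' H']]].
  exists (B + B'), (Rmin d d'). split; [apply Rmin_glb_lt; assumption|].
  intros z Hz. pose proof (Rmin_l d d'). pose proof (Rmin_r d d').
  eapply Rle_trans; [apply Rabs_triang|].
  specialize (H z ltac:(lra)). specialize (H' z ltac:(lra)). lra.
Qed.

Lemma right_bigO_scal m c f : right_bigO m f -> right_bigO m (fun z => c * f z).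
Proof.
  intros [B [d [Hd H]]]. exists (Rabs c * B), d. split; [exact Hd|].
  intros z Hz. rewrite Rabs_mult, Rmult_assoc.
  apply Rmult_le_compat_l; [apply Rabs_pos|apply H, Hz].
Qed.

Lemma right_bigO_ext m f g : (forall z, f z = g z) -> right_bigO m f -> right_bigO m g.
Proof.
  intros E [B [d [Hd H]]]. exists B, d. split; [exact Hd|].
  intros z Hz. rewrite <- E. apply H, Hz.
Qed.

(** Lagrange's remainder, whose derivative of order [m] is bounded near 0 by continuity. Order 0 is
    separate because that formula starts at order 1. *)
Lemma elem_taylor f m : elem f ->
  right_bigO m (fun z => f z - psum (fun i => coef0 i f * z ^ i) m).
Proof.
  intros Hf. destruct (elem_Derive_n f m Hf) as [g [Hg E]].
  destruct (elem_derive g Hg) as [g' [_ D]].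
  assert (Hc : continuous g 0).
  { apply continuous_of_ex_derive. exists (g' 0). apply D. lra. }
  destruct (proj1 (filterlim_locally _ _) Hc (mkposreal 1 Rlt_0_1)) as [d Hd].
  exists (Rabs (g 0) + 1), (Rmin d (1 / 2)). split; [apply Rmin_glb_lt; [apply cond_pos|lra]|].
  intros z Hz. pose proof (Rmin_l d (1 / 2)). pose proof (Rmin_r d (1 / 2)).
  assert (Hg1 : forall y, 0 <= y <= z -> Rabs (g y) <= Rabs (g 0) + 1).
  { intros y Hy. assert (Hyd : ball 0 d y).
    { change (Rabs (y - 0) < d). rewrite Rminus_0_r, Rabs_pos_eq; lra. }
    specialize (Hd y Hyd). change (Rabs (g y - g 0) < 1) in Hd.
    pose proof (Rabs_triang_inv (g y) (g 0)). lra. }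
  destruct m as [|n].
  - simpl. rewrite Rminus_0_r, Rmult_1_r. change (f z) with (Derive_n f 0 z).
    rewrite E by lra. apply Hg1. lra.
  - destruct (Taylor_Lagrange f n 0 z) as [y [Hy Ey]]; [lra| |].
    { intros t Ht k _. apply elem_ex_derive_n; [exact Hf|lra]. }
    rewrite Ey, Rminus_0_r, <- sum_n_Reals, sum_n_psum.
    rewrite (psum_ext (fun i => coef0 i f * z ^ i)
      (fun i => z ^ i / INR (fact i) * Derive_n f i 0))
      by (intros; unfold coef0, Rdiv; ring).
    replace (_ + _ - _) with (z ^ S n / INR (fact (S n)) * Derive_n f (S n) y) by ring.
    rewrite E by lra. rewrite Rabs_mult, Rmult_comm.
    apply Rmult_le_compat; try apply Rabs_pos; [apply Hg1; lra|].
    assert (0 < z ^ S n) by (apply pow_lt; lra).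
    assert (1 <= INR (fact (S n))).
    { change 1 with (INR 1). apply le_INR, lt_O_fact. }
    rewrite Rabs_pos_eq by (apply Rdiv_le_0_compat; lra).
    apply Rle_div_l; [lra|]. nra.
Qed.

(** Letting [z] tend to 0 forces the constant term to vanish; dividing by [z] lowers the degree. *)
Lemma right_bigO_poly_zero m : forall c,
  right_bigO m (fun z => psum (fun i => c i * z ^ i) m) ->
  forall i, (i < m)%nat -> c i = 0.
Proof.
  induction m as [|m IH]; intros c Hc i Hi; [lia|].
  assert (Es : forall z, psum (fun i => c i * z ^ i) (S m)
     = c 0%nat + z * psum (fun i => c (S i) * z ^ i) m).
  { intros z. rewrite psum_S_l, <- psum_scal. simpl (z ^ 0). rewrite Rmult_1_r. f_equal.
    apply psum_ext. intros; simpl; ring. }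
  destruct Hc as [B [d [Hd H]]].
  assert (H0 : c 0%nat = 0).
  { set (s := psum (fun i => Rabs (c (S i))) m).
    set (M := Rabs B + s + 1).
    assert (Hs : 0 <= s).
    { unfold s. replace 0 with (psum (fun _ => 0 * 0) m) by (rewrite psum_scal; ring).
      apply psum_le. intros. rewrite Rmult_0_l. apply Rabs_pos. }
    assert (HM : 1 <= M) by (unfold M; pose proof (Rabs_pos B); lra).
    apply Rabs_eq_0, Rle_antisym; [|apply Rabs_pos]. apply Rnot_lt_le. intros Hlt.
    (* All other terms are at most [z M] together, so this [z] yields [|c 0| <= |c 0| / 2]. *)
    set (z := Rmin (Rmin (d / 2) 1) (Rabs (c 0%nat) / (2 * M))).
    assert (Hz : 0 < z).
    { unfold z. repeat apply Rmin_glb_lt; try lra. apply Rdiv_lt_0_compat; lra. }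
    assert (Hz1 : z <= Rmin (d / 2) 1) by apply Rmin_l.
    assert (Hz2 : z <= Rabs (c 0%nat) / (2 * M)) by apply Rmin_r.
    pose proof (Rmin_l (d / 2) 1). pose proof (Rmin_r (d / 2) 1).
    specialize (H z ltac:(lra)). rewrite Es in H.
    assert (Hzm : forall j, 0 < z ^ j <= 1).
    { intros j. split; [apply pow_lt, Hz|]. apply Rle_trans with (1 ^ j); [apply pow_incr; lra|rewrite pow1; lra]. }
    assert (Hp : Rabs (psum (fun i => c (S i) * z ^ i) m) <= s).
    { eapply Rle_trans; [apply Rabs_psum|]. apply psum_le. intros j _.
      rewrite Rabs_mult, (Rabs_pos_eq (z ^ j)) by (left; apply Hzm).
      rewrite <- (Rmult_1_r (Rabs (c (S j)))) at 2.
      apply Rmult_le_compat_l; [apply Rabs_pos|apply Hzm]. }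
    set (q := psum (fun i => c (S i) * z ^ i) m) in *.
    assert (Hq : Rabs (z * q) <= z * s).
    { rewrite Rabs_mult, (Rabs_pos_eq z) by lra. apply Rmult_le_compat_l; lra. }
    assert (HB : B * z ^ S m <= z * Rabs B).
    { simpl. pose proof (Hzm m). pose proof (Rle_abs B). pose proof (Rabs_pos B).
      replace (B * (z * z ^ m)) with (z * (B * z ^ m)) by ring.
      apply Rmult_le_compat_l; [lra|].
      apply Rle_trans with (Rabs B * z ^ m); [apply Rmult_le_compat_r; lra|nra]. }
    assert (Hc : Rabs (c 0%nat) <= z * M).
    { replace (c 0%nat) with ((c 0%nat + z * q) + - (z * q)) by ring.
      eapply Rle_trans; [apply Rabs_triang|]. rewrite Rabs_Ropp. unfold M. nra. }
    assert (z * M <= Rabs (c 0%nat) / 2).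
    { replace (Rabs (c 0%nat) / 2) with (Rabs (c 0%nat) / (2 * M) * M) by (field; lra).
      apply Rmult_le_compat_r; lra. }
    lra. }
  destruct i as [|i]; [exact H0|].
  apply (IH (fun i => c (S i))); [|lia].
  exists B, d. split; [exact Hd|]. intros z Hz.
  specialize (H z Hz). rewrite Es, H0, Rplus_0_l, Rabs_mult, (Rabs_pos_eq z) in H by lra.
  apply Rmult_le_reg_l with z; [lra|]. simpl in H. lra.
Qed.

(** The passage from estimates to derivatives: any expansion with a small enough remainder must be
    the Taylor expansion. *)
Lemma coef0_unique f c m : elem f ->
  right_bigO m (fun z => f z - psum (fun i => c i * z ^ i) m) ->
  forall i, (i < m)%nat -> coef0 i f = c i.
Proof.
  intros Hf Hc i Hi. apply Rminus_diag_uniq.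
  apply (right_bigO_poly_zero m (fun i => coef0 i f - c i)); [|exact Hi].
  apply right_bigO_ext with (2 := right_bigO_plus _ _ _ Hc
    (right_bigO_scal _ (-1) _ (elem_taylor f m Hf))).
  intros z. rewrite (psum_ext (fun i => (coef0 i f - c i) * z ^ i)
    (fun i => coef0 i f * z ^ i + -1 * (c i * z ^ i))) by (intros; ring).
  rewrite psum_plus, psum_scal. ring.
Qed.

Lemma coef0_ext r f g : (forall z, f z = g z) -> coef0 r f = coef0 r g.
Proof. intros E. unfold coef0. f_equal. apply Derive_n_ext, E. Qed.

Lemma coef0_psum r a (f : nat -> R -> R) K : (forall s, elem (f s)) ->
  coef0 r (fun z => psum (fun s => a s * f s z) K) = psum (fun s => a s * coef0 r (f s)) K.
Proof.
  intros Hf. induction K as [|K IH]; simpl.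
  - unfold coef0. rewrite <- (Rmult_0_l (/ INR (fact r))). unfold Rdiv. f_equal.
    rewrite (Derive_n_ext _ (fun x => 0 * x)) by (intros; ring).
    rewrite Derive_n_scal_l. ring.
  - rewrite <- IH. unfold coef0.
    rewrite Derive_n_plus.
    + rewrite Derive_n_scal_l. unfold Rdiv. ring.
    + apply elem_locally_ex_derive_n; [|lra].
      apply (elem_psum (fun s z => a s * f s z)). intros i _.
      apply (elem_mult (fun _ => a i)); [constructor|apply Hf].
    + apply elem_locally_ex_derive_n; [|lra].
      apply (elem_mult (fun _ => a K)); [constructor|apply Hf].
Qed.

Lemma coef0_bigO f m i : elem f -> right_bigO m f -> (i < m)%nat -> coef0 i f = 0.
Proof.
  intros Hf H Hi. apply (coef0_unique f (fun _ => 0) m); [exact Hf| |exact Hi].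
  apply right_bigO_ext with (2 := H). intros z. rewrite psum_scal. ring.
Qed.

Lemma elem_sqr_sub_1 : elem (fun z => z ^ 2 - 1).
Proof.
  apply (elem_plus (fun z => z ^ 2) (fun _ => - (1))); [|constructor].
  apply (elem_pow (fun z => z)). constructor.
Qed.

Lemma coef0_mul_sqr_sub_1 f r : elem f ->
  coef0 (S (S r)) (fun z => (z ^ 2 - 1) * f z) = coef0 r f - coef0 (S (S r)) f.
Proof.
  intros Hf.
  (* The coefficients of [z^2 f]: those of [f] shifted by two. Multiplication by [z^2] also raises
     the order of the remainder by two. *)
  set (b := fun i => match i with S (S j) => coef0 j f | _ => 0 end).
  set (c := fun i => b i - coef0 i f).
  change (coef0 r f - coef0 (S (S r)) f) with (c (S (S r))).
  apply (coef0_unique _ c (S (S (S r)))); [|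
    |lia].
  - apply (elem_mult (fun z => z ^ 2 - 1)); [apply elem_sqr_sub_1|exact Hf].
  - pose proof (elem_taylor f (S r) Hf) as H1.
    assert (H2 : right_bigO (S (S (S r)))
       (fun z => z ^ 2 * (f z - psum (fun i => coef0 i f * z ^ i) (S r)))).
    { destruct H1 as [B [d [Hd H]]]. exists B, d. split; [exact Hd|]. intros z Hz.
      rewrite Rabs_mult, (Rabs_pos_eq (z ^ 2)) by apply pow2_ge_0.
      replace (B * z ^ S (S (S r))) with (z ^ 2 * (B * z ^ S r)) by (simpl; ring).
      apply Rmult_le_compat_l; [apply pow2_ge_0|apply H, Hz]. }
    apply right_bigO_ext with (2 := right_bigO_plus _ _ _ H2
      (right_bigO_scal _ (-1) _ (elem_taylor f (S (S (S r))) Hf))).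
    intros z.
    rewrite (psum_ext (fun i => c i * z ^ i)
      (fun i => b i * z ^ i + -1 * (coef0 i f * z ^ i)))
      by (intros; unfold c; ring).
    rewrite psum_plus, psum_scal.
    rewrite (psum_S_l (fun i => b i * z ^ i)), (psum_S_l (fun i => b (S i) * z ^ S i)).
    change (b 0%nat) with 0. change (b 1%nat) with 0.
    rewrite (psum_ext (fun j => b (S (S j)) * z ^ S (S j)) (fun j => z ^ 2 * (coef0 j f * z ^ j)))
      by (intros; unfold b; simpl; ring).
    rewrite psum_scal. ring.
Qed.

(** The [r]-th derivative of [f (- z)] at 0, computed by the chain rule and by the hypothesis,
    carries opposite signs. *)
Lemma coef0_parity f r : elem f -> (forall z, f (- z) = (-1) ^ S r * f z) -> coef0 r f = 0.
Proof.
  intros Hf E. unfold coef0.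
  assert (H : Derive_n (fun y => f (- y)) r 0 = (-1) ^ r * Derive_n f r 0).
  { rewrite Derive_n_comp_opp; rewrite Ropp_0; [reflexivity|].
    apply elem_locally_ex_derive_n; [exact Hf|lra]. }
  rewrite (Derive_n_ext _ _ _ _ E), Derive_n_scal_l in H. simpl in H.
  assert ((-1) ^ r <> 0) by (apply pow_nonzero; lra).
  assert (Derive_n f r 0 = 0); [|unfold Rdiv; rewrite H1; ring].
  apply Rmult_eq_reg_l with ((-1) ^ r); [lra|assumption].
Qed.

(** The derivative is at most 2 on this range. The bound turns remainders in [asin z] into powers of
    [z] and ensures [|asin z| <= 1], as the expansion in [t] requires. *)
Lemma Rabs_asin_le z : 0 < z <= 1 / 2 -> Rabs (asin z) <= 2 * z.
Proof.
  intros Hz.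
  assert (Hw : forall t, 0 <= t <= z -> 0 <= / sqrt (1 - t ^ 2) <= 2).
  { intros t Ht. assert (Ht2 : t ^ 2 <= 1 / 4) by nra.
    assert (1 / 2 <= sqrt (1 - t ^ 2)).
    { rewrite <- (sqrt_pow2 (1 / 2)) by lra. apply sqrt_le_1_alt. lra. }
    split; [left; apply Rinv_0_lt_compat; lra|].
    replace 2 with (/ (1 / 2)) by field. apply Rinv_le_contravar; lra. }
  apply Rabs_le. split.
  - apply Rle_trans with 0; [lra|].
    apply (le_of_derive_le (fun _ => 0) asin (fun _ => 0) (fun t => / sqrt (1 - t ^ 2)));
      [lra|rewrite asin_0; lra| | |apply Hw].
    + intros. auto_derive; auto.
    + intros. apply is_derive_asin. lra.
  - apply (le_of_derive_le asin (fun t => 2 * t) (fun t => / sqrt (1 - t ^ 2)) (fun _ => 2));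
      [lra|rewrite asin_0; lra| | |apply Hw].
    + intros. apply is_derive_asin. lra.
    + intros. auto_derive; auto. ring.
Qed.

(** * Comparison of coefficients *)

Lemma sinh_cosh_int_coef0 m :
  sinh_cosh_int m =
  psum (fun s => lerch_coef (S s) * coef0 (S m) (fun z => asin z ^ S s)) (S m).
Proof.
  assert (He : forall s, elem (fun z => asin z ^ S s)).
  { intros s. apply (elem_pow asin). constructor. }
  rewrite <- (coef0_psum (S m) (fun s => lerch_coef (S s)) (fun s z => asin z ^ S s) (S m) He).
  (* [sinh_cosh_int j] belongs to [z^(j+1)], and there is no constant term. *)
  set (c := fun i => match i with 0%nat => 0 | S j => sinh_cosh_int j end).
  symmetry. change (sinh_cosh_int m) with (c (S m)).
  apply (coef0_unique _ c (S (S m))); [| |lia].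
  - apply (elem_psum (fun s z => lerch_coef (S s) * asin z ^ S s)). intros s _.
    apply (elem_mult (fun _ => lerch_coef (S s))); [constructor|apply He].
  - exists (24 * 2 ^ S m * 2 ^ S (S m) + 4), (1 / 2). split; [lra|]. intros z Hz.
    pose proof (Rabs_asin_le z ltac:(lra)) as Ha.
    assert (Es : sin (asin z) = z) by (apply sin_asin; lra).
    pose proof (sinh_cosh_int_expansion (asin z) (S m)) as H.
    rewrite Es, (Rabs_pos_eq z) in H by lra. specialize (H ltac:(lra) ltac:(lra)).
    rewrite (psum_S_l (fun i => c i * z ^ i)). change (c 0%nat) with 0.
    rewrite (psum_ext (fun i => c (S i) * z ^ S i) (fun i => z ^ S i * sinh_cosh_int i))
      by (intros; unfold c; ring).
    rewrite Rmult_0_l, Rplus_0_l, Rabs_minus_sym.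
    eapply Rle_trans; [exact H|].
    assert (Hp : Rabs (asin z) ^ S (S m) <= 2 ^ S (S m) * z ^ S (S m)).
    { rewrite <- Rpow_mult_distr. apply pow_incr. split; [apply Rabs_pos|exact Ha]. }
    pose proof (pow_lt 2 (S m) ltac:(lra)). nra.
Qed.

(** * Higher odd powers of [sinh] and the final summation *)

Definition asin_term (k s : nat) (z : R) : R := (z ^ 2 - 1) ^ k * asin z ^ s.

Lemma elem_asin_term k s : elem (asin_term k s).
Proof.
  apply (elem_mult (fun z => (z ^ 2 - 1) ^ k) (fun z => asin z ^ s)).
  - apply (elem_pow (fun z => z ^ 2 - 1)), elem_sqr_sub_1.
  - apply (elem_pow asin). constructor.
Qed.

Lemma coef0_asin_term_low k s r : (r < s)%nat -> coef0 r (asin_term k s) = 0.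
Proof.
  apply coef0_bigO; [apply elem_asin_term|].
  exists (2 ^ s), (1 / 2). split; [lra|]. intros z Hz. unfold asin_term.
  rewrite Rabs_mult, <- !RPow_abs, <- Rpow_mult_distr.
  rewrite <- (Rmult_1_l ((2 * z) ^ s)).
  apply Rmult_le_compat; try apply pow_le, Rabs_pos.
  - apply Rle_trans with (1 ^ k); [|rewrite pow1; lra].
    apply pow_incr. split; [apply Rabs_pos|]. apply Rabs_le. nra.
  - apply pow_incr. split; [apply Rabs_pos|apply Rabs_asin_le; lra].
Qed.

Lemma coef0_asin_term_parity k s r : (-1) ^ S r = (-1) ^ s -> coef0 r (asin_term k s) = 0.
Proof.
  intros H. apply coef0_parity; [apply elem_asin_term|].
  intros z. rewrite H. unfold asin_term. rewrite asin_opp.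
  replace ((- z) ^ 2) with (z ^ 2) by ring.
  replace (- asin z) with (-1 * asin z) by ring. rewrite Rpow_mult_distr. ring.
Qed.

Lemma coef0_asin_term_step k s r :
  coef0 (S (S r)) (asin_term (S k) s) = coef0 r (asin_term k s) - coef0 (S (S r)) (asin_term k s).
Proof.
  rewrite <- coef0_mul_sqr_sub_1 by apply elem_asin_term.
  apply coef0_ext. intros z. unfold asin_term. simpl. ring.
Qed.

(** The condition on [m] is exactly convergence at infinity: for [m = 2 k - 1] the integrand behaves
    like [1 / x]. The induction step for [m + 2] uses the hypothesis at both [m] and [m + 2]. *)
Lemma sinh_pow_cosh_pow_int k : forall m, (2 * k <= m)%nat ->
  int0oo (fun x => sinh x ^ (2 * k + 1) / (x * cosh x ^ (m + 2)))
    (psum (fun s => lerch_coef (S s) * coef0 (S m) (asin_term k (S s))) (S m)).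
Proof.
  induction k as [|k IH]; intros m Hm.
  - rewrite (psum_ext _ (fun s => lerch_coef (S s) * coef0 (S m) (fun z => asin z ^ S s))).
    + rewrite <- sinh_cosh_int_coef0.
      apply int0oo_ext with (2 := sinh_cosh_int_correct m).
      intros x _. simpl (2 * 0 + 1)%nat. rewrite pow_1. reflexivity.
    + intros s _. f_equal. apply coef0_ext. intros z. unfold asin_term. simpl. ring.
  - destruct m as [|[|m]]; [lia|lia|].
    assert (E : psum (fun s => lerch_coef (S s) * coef0 (S (S (S m))) (asin_term (S k) (S s))) (S (S (S m)))
      = psum (fun s => lerch_coef (S s) * coef0 (S m) (asin_term k (S s))) (S m)
        + -1 * psum (fun s => lerch_coef (S s) * coef0 (S (S (S m))) (asin_term k (S s))) (S (S (S m)))).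
    { rewrite (psum_ext _ (fun s => lerch_coef (S s) * coef0 (S m) (asin_term k (S s))
        + -1 * (lerch_coef (S s) * coef0 (S (S (S m))) (asin_term k (S s)))))
        by (intros; rewrite coef0_asin_term_step; ring).
      rewrite psum_plus, psum_scal. f_equal.
      (* The two sums differ in length; the extra terms contain [asin z] to the powers [m + 2] and
         [m + 3], which have no [z^(m+1)] coefficient. *)
      change (psum ?f (S (S (S m)))) with (psum f (S m) + f (S m) + f (S (S m))). cbv beta.
      rewrite !(coef0_asin_term_low k _ (S m)) by lia. ring. }
    rewrite E.
    apply int0oo_ext with (2 := int0oo_plus _ _ _ _ (IH m ltac:(lia))
      (int0oo_scal _ (-1) _ (IH (S (S m)) ltac:(lia)))).
    intros x Hx. cbv beta.
    replace (2 * S k + 1)%nat with (S (S (2 * k + 1))) by lia.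
    replace (S (S m) + 2)%nat with (S (S (m + 2))) by lia.
    pose proof (cosh_ge_1 x). assert (cosh x ^ (m + 2) <> 0) by (apply pow_nonzero; lra).
    assert (Es : sinh x ^ 2 = cosh x ^ 2 - 1).
    { unfold sinh, cosh. pose proof (exp_plus x (- x)) as Hexp.
      rewrite Rplus_opp_r, exp_0 in Hexp. nra. }
    replace (sinh x ^ S (S (2 * k + 1))) with (sinh x ^ 2 * sinh x ^ (2 * k + 1)) by (simpl; ring).
    rewrite Es. simpl (cosh x ^ S _).
    match goal with |- ?a = ?b => change (@eq R a b) end. field. lra.
Qed.

Lemma sum_n_m_1_psum f n : (1 <= n)%nat -> sum_n_m f 1 n = psum (fun j => f (S j)) n.
Proof.
  intros Hn. destruct n as [|n]; [lia|].
  rewrite <- sum_n_m_S. apply sum_n_psum.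
Qed.

(** On the positive base [j + 1/2] the real power with a natural exponent is the ordinary one, and
    [((-1)^s)^j = ((-1)^j)^s]. *)
Lemma Lerch_lerch_coef q s : q = (-1) ^ s ->
  Lerch q (INR (S s)) (1 / 2) / PI ^ s = lerch_coef s.
Proof.
  intros ->. unfold Lerch, lerch_coef. f_equal. apply Series_ext. intros j.
  rewrite Rpower_pow by (pose proof (pos_INR j); lra).
  rewrite <- !pow_mult, (Nat.mul_comm s j). reflexivity.
Qed.

Theorem proposition3p3 (n k eps : nat)
    (hn : (1 <= n)%nat) (hk : (k < n)%nat) (heps : eps = 0%nat \/ eps = 1%nat) :
  is_RInt_gen
    (fun x : R => sinh x ^ (2 * k + 1) / (x * cosh x ^ (2 * n + eps)))
    (at_right 0) (Rbar_locally p_infty)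
    (sum_n_m
       (fun p : nat =>
          Lerch (2 * INR eps - 1) (INR (2 * p + eps)) (1 / 2)
            / PI ^ (2 * p - 1 + eps)
          * coef0 (2 * n - 1 + eps)
              (fun z : R => (z ^ 2 - 1) ^ k * asin z ^ (2 * p - 1 + eps)))
       1 n).
Proof.
  pose proof (sinh_pow_cosh_pow_int k (2 * n + eps - 2) ltac:(lia)) as H.
  replace (2 * n + eps - 2 + 2)%nat with (2 * n + eps)%nat in H by lia.
  replace (S (2 * n + eps - 2)) with (2 * n - 1 + eps)%nat in H by lia.
  rewrite sum_n_m_1_psum by exact hn.
  set (g := fun s => lerch_coef (S s) * coef0 (2 * n - 1 + eps) (asin_term k (S s))) in H.
  (* For [eps = 0] one term is missing to form pairs; the added one has [asin z] to the power [2 n]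
     and a zero coefficient at [z^(2n-1)]. *)
  assert (Hsum : psum g (2 * n - 1 + eps) = psum g (2 * n)).
  { destruct heps as [-> | ->]; [|f_equal; lia].
    replace (2 * n)%nat with (S (2 * n - 1 + 0)) at 2 by lia. cbn [psum]. unfold g at 3.
    rewrite coef0_asin_term_low by lia. ring. }
  rewrite Hsum, psum_double in H.
  match goal with |- is_RInt_gen _ _ _ ?S => replace S with
    (psum (fun j => g (2 * j)%nat + g (2 * j + 1)%nat) n); [exact H|] end.
  assert (Hodd : forall i, (-1) ^ (2 * i + 1) = -1)
    by (intros i; rewrite Nat.add_1_r; apply pow_1_odd).
  apply psum_ext. intros j Hj. unfold g.
  (* With [p = j + 1], each pair holds the powers [2 p - 1] and [2 p] of [asin z]. Parity removes
     the second for [eps = 0] and the first for [eps = 1]. *)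
  destruct heps as [-> | ->].
  - rewrite (coef0_asin_term_parity k (S (2 * j + 1))).
    + replace (2 * S j - 1 + 0)%nat with (S (2 * j)) by lia.
      replace (2 * S j + 0)%nat with (S (S (2 * j))) by lia.
      rewrite Lerch_lerch_coef.
      * unfold asin_term. ring.
      * rewrite pow_1_odd. simpl. ring.
    + replace (S (2 * n - 1 + 0)) with (2 * n)%nat by lia.
      replace (S (2 * j + 1)) with (2 * S j)%nat by lia. rewrite !pow_1_even. reflexivity.
  - rewrite (coef0_asin_term_parity k (S (2 * j))).
    + replace (2 * S j - 1 + 1)%nat with (S (2 * j + 1)) by lia.
      replace (2 * S j + 1)%nat with (S (S (2 * j + 1))) by lia.
      rewrite Lerch_lerch_coef.
      * unfold asin_term. ring.
      * replace (S (2 * j + 1)) with (2 * S j)%nat by lia. rewrite pow_1_even. simpl. ring.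
    + replace (S (2 * n - 1 + 1)) with (2 * n + 1)%nat by lia.
      rewrite Hodd, pow_1_odd. reflexivity.
Qed.
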